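(* Let $0<s<1$, and for small $\epsilon>0$ let $\phi_\epsilon\in\mathcal K$ be the solution of $\Delta\phi_\epsilon=G_\epsilon(\phi_\epsilon)$ in $\mathbb T^{++}$, and let $\Psi_\epsilon$ be the barrier function (both defined in the context). There exists a fixed constant $\sigma\in(0,\frac{s}{100})$ such that for all sufficiently small $\epsilon>0$ and all $x\in\mathbb T^{++}$ satisfying $$|x|\le \frac{\sqrt{\epsilon}}{-\ln\epsilon},$$ we have $$\Psi_\epsilon(x)\le\phi_\epsilon(x)\le\Psi_\epsilon(x)\bigl(1+\epsilon^{-\sigma}|x|^{\sigma}\bigr).$$
   Context: Fix $0<s<1$. $\mathbb T^2=[-\frac12,\frac12]^2/\!\sim$ is the flat torus (periodic with period 1 in each variable), $\mathbb T^{++}=\{0<x_1<\frac12,\ 0<x_2<\frac12\}$, $\mathbb R^{++}=\{x_1>0,x_2>0\}$. $\Delta^{-1}$ on $\mathbb T^2$ is convolution with the Green's function of the Laplacian. Bahouri-Chemin stream function: $\psi_0=\Delta^{-1}[-\operatorname{sgn}(x_1)\operatorname{sgn}(x_2)]$ on $\mathbb T^2$, where $\operatorname{sgn}(t)=-1$ for $t<0$ and $1$ for $t\ge0$ (so $\psi_0$ is odd in each variable, positive in $\mathbb T^{++}$, and vanishes on $\partial\mathbb T^{++}$). Nonlinearity: $G_\epsilon$ is the odd function with $G_\epsilon(t)=-\epsilon^s/t^s$ for $0<t<\epsilon$ and $G_\epsilon(t)=-1$ for $t\ge\epsilon$. Symmetry class: $\mathcal K$ is the set of functions $\phi$ on $\mathbb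 T^2$ with $\phi(x_1,x_2)=-\phi(x_1,-x_2)=-\phi(-x_1,x_2)=\phi(x_2,x_1)$ and $\phi\ge\psi_0$ on $\mathbb T^{++}$. Known from earlier work: for small $\epsilon>0$ there is a solution $\phi_\epsilon\in\mathcal K\cap C^1(\mathbb T^2)$ of $\Delta\phi_\epsilon=G_\epsilon(\phi_\epsilon)$ in $\mathbb T^{++}$; it satisfies $\phi_\epsilon=\Delta^{-1}(G_\epsilon(\phi_\epsilon))$ on $\mathbb T^2$, and it is the unique non-negative solution in $\mathbb T^{++}$. Barrier function: $\Psi_\epsilon$ is the function, positive in $\mathbb R^{++}$, homogeneous of degree $\frac{2}{1+s}$, with $\Delta\Psi_\epsilon=-\epsilon^s\Psi_\epsilon^{-s}$ in $\mathbb R^{++}$ and $\Psi_\epsilon=0$ on $\partial\mathbb R^{++}$ (extended to $\mathbb R^2$ by oddness in each variable). In polar coordinates on $\mathbb R^{++}$ it satisfies $\frac1C\epsilon^{\frac{s}{s+1}}r^{\frac{2}{s+1}}\sin(2\theta)<\Psi_\epsilon(r,\theta)<C\epsilon^{\frac{s}{s+1}}r^{\frac{2}{s+1}}\sin(2\theta)$ with $C=C(s)$. *)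

(* Defs.v *)
From HB Require Import structures.
From mathcomp Require Import all_boot all_order all_algebra.
From mathcomp Require Import all_classical all_reals all_analysis.
Import Order.TTheory GRing.Theory Num.Theory numFieldNormedType.Exports.

Set Implicit Arguments.
Unset Strict Implicit.
Unset Printing Implicit Defensive.

Local Open Scope classical_set_scope.
Local Open Scope ring_scope.

Section Plane.
Context {R : realType}.
Implicit Types (f : R * R -> R) (U : set (R * R)) (x : R * R).

Definition e1 : R * R := (1, 0).
Definition e2 : R * R := (0, 1).

(* The library norm on [R * R] is the sup norm, hence this definition. *)
Definition enorm x : R := Num.sqrt (x.1 ^+ 2 + x.2 ^+ 2).

(* [C1_on] and [C2_on] are meant for open [U]. *)
Definition C1_on U f : Prop :=
  forall x, U x ->
    [/\ derivable f x e1, derivable f x e2,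
        {for x, continuous ('D_e1 f)} & {for x, continuous ('D_e2 f)}].

Definition C2_on U f : Prop :=
  [/\ C1_on U f, C1_on U ('D_e1 f) & C1_on U ('D_e2 f)].

Definition laplacian f x : R := 'D_e1 ('D_e1 f) x + 'D_e2 ('D_e2 f) x.

Definition Rpp : set (R * R) := [set x | 0 < x.1 /\ 0 < x.2].

Definition Rpp_closed : set (R * R) := [set x | 0 <= x.1 /\ 0 <= x.2].

Definition Tpp : set (R * R) :=
  [set x | 0 < x.1 < 2^-1 /\ 0 < x.2 < 2^-1].

End Plane.

(* Functions on the torus are functions on the plane with period 1 in each
   variable; integrals over the torus are integrals over [torus_cell]. *)
Section Torus.
Context {R : realType}.

Definition biperiodic (f : R * R -> R) : Prop :=
  forall x, f (x + e1) = f x /\ f (x + e2) = f x.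

(* [measurableTypeR R] is [R] with the Borel sigma-algebra that carries
   [lebesgue_measure]; the default measurable structure of [R] has another
   display and does not unify with it. *)
Local Notation mR := (measurableTypeR R).

Definition torus_cell : set (mR * mR) :=
  `[- 2^-1, 2^-1]%classic `*` `[- 2^-1, 2^-1]%classic.

Local Notation area := ((@lebesgue_measure R) \x (@lebesgue_measure R))%E.

Definition torus_int (f : mR * mR -> R) : R :=
  (\int[area]_(x in torus_cell) f x)%R.

Definition torus_conv (K f : R * R -> R) (x : R * R) : R :=
  torus_int (fun y => K (x - y) * f y).

(* The last field is [Delta K = delta_0 - 1] in the sense of distributions;
   the total mass of the torus is 1, so [torus_int u] is the mean of [u].
   These conditions determine [K] almost everywhere. *)
Record is_torus_green (K : R * R -> R) : Prop := IsTorusGreen {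
  green_periodic : biperiodic K ;
  green_integrable : area.-integrable torus_cell (EFin \o (K : mR * mR -> R)) ;
  green_mean0 : torus_int K = 0 ;
  green_repr : forall u, biperiodic u -> C2_on setT u ->
    forall x, torus_conv K (laplacian u) x = u x - torus_int u }.

Definition sgn (t : R) : R := if t < 0 then -1 else 1.

(* The formula for the density is used only on [torus_cell]. *)
Definition bahouri_chemin (K : R * R -> R) : R * R -> R :=
  torus_conv K (fun y => - (sgn y.1 * sgn y.2)).

Record sym_class (K phi : R * R -> R) : Prop := SymClass {
  sym_periodic : biperiodic phi ;
  sym_odd2 : forall x1 x2, phi (x1, x2) = - phi (x1, - x2) ;
  sym_odd1 : forall x1 x2, phi (x1, x2) = - phi (- x1, x2) ;
  sym_swap : forall x1 x2, phi (x1, x2) = phi (x2, x1) ;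
  sym_ge : forall x, Tpp x -> bahouri_chemin K x <= phi x }.

End Torus.

Section Problem.
Context {R : realType}.

Definition Gpos (s eps t : R) : R :=
  if t < eps then - (eps `^ s / t `^ s) else -1.

Definition G (s eps t : R) : R :=
  if 0 < t then Gpos s eps t
  else if t < 0 then - Gpos s eps (- t) else 0.

Record is_solution (K : R * R -> R) (s eps : R) (phi : R * R -> R) : Prop :=
  IsSolution {
  sol_sym : sym_class K phi ;
  sol_C1 : C1_on setT phi ;
  sol_C2 : C2_on Tpp phi ;
  sol_eq : forall x, Tpp x -> laplacian phi x = G s eps (phi x) }.

Record is_barrier (s eps : R) (Psi : R * R -> R) : Prop := IsBarrier {
  barrier_gt0 : forall x, Rpp x -> 0 < Psi x ;
  barrier_homogeneous : forall (l : R) x, 0 < l -> Rpp x ->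
    Psi (l * x.1, l * x.2) = l `^ (2 / (1 + s)) * Psi x ;
  barrier_continuous : {within Rpp_closed, continuous Psi} ;
  barrier_C2 : C2_on Rpp Psi ;
  barrier_eq : forall x, Rpp x ->
    laplacian Psi x = - (eps `^ s * Psi x `^ (- s)) ;
  barrier_boundary : forall x, (Rpp_closed `\` Rpp) x -> Psi x = 0 ;
  barrier_odd1 : forall x1 x2, Psi (- x1, x2) = - Psi (x1, x2) ;
  barrier_odd2 : forall x1 x2, Psi (x1, - x2) = - Psi (x1, x2) }.

End Problem.

(* Main.v *)
Require Import Defs.
From mathcomp Require Import all_boot all_order all_algebra.
From mathcomp Require Import all_classical all_reals all_analysis.
From mathcomp Require Import measurable_realfun ring lra.
Import Order.TTheory GRing.Theory Num.Theory numFieldNormedType.Exports.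

(** Write [X = x1 * x2], [N = |x|^2], [al = 2 / (1 + s)]. The explicit functions
    [mono p b = X^p N^(b/2-p)], homogeneous of degree [b], satisfy
    [Delta (mono p b) = p (p-1) mono (p-2) (b-2) + (b^2 - 4 p^2) mono p (b-2)], and the
    maximum principle does the rest.

    Comparison in the cone with multiples of [mono 1 al] and of [A mono 1 al - mono (2-s) al]
    shows that [Psi] is comparable to [eps^(s/(1+s)) mono 1 al].

    Upper bound: since [|G| <= max(1, eps^s phi^(-s))], the function [Psi + W] is a
    supersolution in the whole of [Tpp] as soon as [- Delta W >= 1]; for
    [W = (B mono 1 b - mono 2 b) / 2], with [b] slightly less than 2, this gives
    [phi <= Psi + B mono 1 b], and [B mono 1 b <= Psi (|x| / eps)^sigma] for
    [|x|^2 <= eps].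

    Lower bound: since [- Delta phi >= 1], [phi] is above a multiple of [- X ln N], which at
    [|x| = sqrt eps / - ln eps] is larger than [Psi] because [2 - al < 1]; inside this
    quarter disc [phi] is a supersolution of the equation of [Psi].

    Positivity of [phi] comes from [phi >= psi0] and [psi0 > 0]: the sign function is the
    bounded limit of odd trigonometric polynomials [q_n], for which the solution [u_n] of
    [Delta u_n = - q_n(x1) q_n(x2)] is explicit and at least [u_0 / 2], and
    [u_n = K * Delta u_n] tends to [psi0] by dominated convergence. *)

Set Implicit Arguments.
Unset Strict Implicit.
Unset Printing Implicit Defensive.
Local Open Scope classical_set_scope.
Local Open Scope ring_scope.

(** * The maximum principle *)

Section SecondDerivative.
Context {R : realType}.
Implicit Types (f g : R -> R) (a d : R).

(** A relation rather than a value, so that sums and multiples combine directly; the first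
    derivative [g'] matters only near [a]. *)
Definition derive2_at g a d : Prop := exists g',
  (\forall t \near a, is_derive (t : R) (1 : R) g (g' t)) /\ is_derive a (1 : R) g' d.

Lemma derive2_atD f g a d e :
  derive2_at f a d -> derive2_at g a e -> derive2_at (f \+ g) a (d + e).
Proof.
move=> [f' [f1 f2]] [g' [g1 g2]]; exists (f' \+ g'); split.
  by near=> t; apply: is_deriveD; near: t.
exact: is_deriveD.
Unshelve. all: by end_near. Qed.

Lemma derive2_atZ f k a d :
  derive2_at f a d -> derive2_at (fun t => k * f t) a (k * d).
Proof.
move=> [f' [f1 f2]]; exists (fun t => k * f' t); split.
  by near=> t; apply: is_deriveZ; near: t.
exact: is_deriveZ.
Unshelve. all: by end_near. Qed.

Lemma derive2_at_eq f g a d : f =1 g -> derive2_at f a d -> derive2_at g a d.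
Proof. by move=> /funext ->. Qed.

(** By Fermat the first derivative vanishes at [a]; if [d] were positive, it would be positive just
    to the right of [a] and [f] would increase strictly there. *)
Lemma derive2_at_max f a d :
  (\forall t \near a, f t <= f a) -> derive2_at f a d -> d <= 0.
Proof.
move=> fmax [f' [f1 f2]]; rewrite leNgt; apply/negP => d0.
have [e /= e0 He] : exists2 e : R, 0 < e &
    forall t : R, `|t - a| < e -> is_derive t (1 : R) f (f' t) /\ f t <= f a.
  have /nbhs_ballP[e e0 He] : \forall t \near a,
      is_derive (t : R) (1 : R) f (f' t) /\ f t <= f a.
    by near=> t; split; near: t.
  by exists e => // t ta; apply: He; rewrite /ball/= distrC.
have f'a : f' a = 0.
  have [] : is_derive a (1 : R) f 0.
    apply: (@derive1_at_max _ f (a - e) (a + e)).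
    - lra.
    - move=> t; rewrite in_itv/= => /andP[t1 t2].
      have [|[]//] := He t; rewrite ltr_norml; lra.
    - rewrite in_itv/=; lra.
    - move=> t; rewrite in_itv/= => /andP[t1 t2].
      have [|//] := He t; rewrite ltr_norml; lra.
  move=> _; have [|[_ +] _] := He a; first by rewrite subrr normr0.
  by move=> ->.
have [e' /= e'0 He'] : exists2 e' : R, 0 < e' &
    forall h, 0 < h < e' -> 0 < f' (a + h).
  have [f2d f2v] := f2.
  have : h^-1 *: (f' (h *: 1 + a) - f' a) @[h --> 0^'] --> d.
    by rewrite -f2v; exact: f2d.
  move=> /(_ _ (lt_nbhsr d0)) /= => -[e' /= e'0 H].
  exists e' => // h /andP[h0 he].
  have := H h; rewrite /= sub0r normrN gtr0_norm// => /(_ he (lt0r_neq0 h0)).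
  rewrite f'a subr0 /GRing.scale/= mulr1 addrC => hf.
  by rewrite -(pmulr_rgt0 (f' (a + h)) (x := h^-1)) ?invr_gt0.
(* Half the smaller radius puts [b] where [f] is at most [f a] and keeps [f'] positive on []a,
   b]]. *)
pose b := a + Num.min e e' / 2.
have m0 : 0 < Num.min e e' by rewrite lt_min e0.
have me : Num.min e e' <= e by rewrite ge_min lexx.
have me' : Num.min e e' <= e' by rewrite ge_min lexx orbT.
have ab : a < b by rewrite /b; lra.
have : f a < f b.
  apply: (@gtr0_derive1_lt_cc _ f a b) => //.
  - move=> t; rewrite in_itv/= => /andP[t1 t2].
    have [|[]//] := He t; rewrite ltr_norml; rewrite /b in t2; lra.
  - move=> t; rewrite in_itv/= => /andP[t1 t2].
    have [|[_ +] _] := He t; first by rewrite ltr_norml; rewrite /b in t2; lra.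
    rewrite derive1E => ->; rewrite -(subrKC a t); apply: He'.
    rewrite /b in t2; lra.
  - apply: derivable_within_continuous => t; rewrite in_itv/= => /andP[t1 t2].
    have [|[]//] := He t; rewrite ltr_norml; rewrite /b in t2; lra.
  - by rewrite in_itv/= lexx/= ltW.
  - by rewrite in_itv/= lexx/= ltW.
apply/negP; rewrite -leNgt.
have [|//] := He b; rewrite /b ltr_norml; lra.
Unshelve. all: by end_near. Qed.

End SecondDerivative.

(** * Pointwise Laplacians and the weak maximum principle *)

Section LaplacianAt.
Context {R : realType}.
Implicit Types (f g v : R * R -> R) (x : R * R) (l m : R).

(** Only the restrictions of [f] to the two coordinate lines through [x] enter, which is all that
    the maximum principle uses. *)
Definition laplacian_at f x l : Prop := exists l1 l2,
  [/\ derive2_at (fun t => f (t, x.2)) x.1 l1,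
      derive2_at (fun t => f (x.1, t)) x.2 l2 & l = l1 + l2].

Lemma laplacian_atD f g x l m :
  laplacian_at f x l -> laplacian_at g x m -> laplacian_at (f \+ g) x (l + m).
Proof.
move=> [a [b [fa fb ->]]] [c [d [gc gd ->]]]; exists (a + c), (b + d).
by split; [exact: derive2_atD|exact: derive2_atD|rewrite addrACA].
Qed.

Lemma laplacian_atZ f k x l :
  laplacian_at f x l -> laplacian_at (fun y => k * f y) x (k * l).
Proof.
move=> [a [b [fa fb ->]]]; exists (k * a), (k * b).
by split; [exact: (derive2_atZ k fa)|exact: (derive2_atZ k fb)|rewrite mulrDr].
Qed.

Lemma laplacian_atB f g x l m : laplacian_at f x l -> laplacian_at g x m ->
  laplacian_at (fun y => f y - g y) x (l - m).
Proof.
move=> fl /(laplacian_atZ (-1)); rewrite mulN1r => gm.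
have := laplacian_atD fl gm; congr laplacian_at.
by apply/funext => y /=; rewrite mulN1r.
Qed.

Lemma near_section1 (P : R * R -> Prop) x :
  (\forall y \near x, P y) -> \forall t \near x.1, P (t, x.2).
Proof.
case: x => a b; move=> /nbhs_ballP[e /= e0 H]; apply/nbhs_ballP; exists e => //= t ta.
by apply: H; split => //=; exact: ballxx.
Qed.

Lemma near_section2 (P : R * R -> Prop) x :
  (\forall y \near x, P y) -> \forall t \near x.2, P (x.1, t).
Proof.
case: x => a b; move=> /nbhs_ballP[e /= e0 H]; apply/nbhs_ballP; exists e => //= t ta.
by apply: H; split => //=; exact: ballxx.
Qed.

(** Both difference quotients are the same function of [h], since a step along [e1] moves only the
    first coordinate. *)
Lemma is_derive_section1 f (a b d : R) :
  is_derive (a, b) (e1 : R * R) f d <-> is_derive a (1 : R) (fun t => f (t, b)) d.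
Proof.
have E : (fun h : R => h^-1 *: ((f \o shift (a, b)) (h *: e1) - f (a, b))) =
    (fun h : R => h^-1 *: (((fun t => f (t, b)) \o shift a) (h *: 1) - f (a, b))).
  apply/funext => h /=; congr (_ *: (f _ - _)).
  rewrite /shift/= (_ : h *: e1 + (a, b) = (h *: 1 + a, h *: 0 + b))//.
  by rewrite scaler0 add0r.
by split => -[D V]; split;
  [move: D; rewrite /derivable E|move: V; rewrite /derive E|
   rewrite /derivable E|rewrite /derive E].
Qed.

Lemma is_derive_section2 f (a b d : R) :
  is_derive (a, b) (e2 : R * R) f d <-> is_derive b (1 : R) (fun t => f (a, t)) d.
Proof.
have E : (fun h : R => h^-1 *: ((f \o shift (a, b)) (h *: e2) - f (a, b))) =
    (fun h : R => h^-1 *: (((fun t => f (a, t)) \o shift b) (h *: 1) - f (a, b))).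
  apply/funext => h /=; congr (_ *: (f _ - _)).
  rewrite /shift/= (_ : h *: e2 + (a, b) = (h *: 0 + a, h *: 1 + b))//.
  by rewrite scaler0 add0r.
by split => -[D V]; split;
  [move: D; rewrite /derivable E|move: V; rewrite /derive E|
   rewrite /derivable E|rewrite /derive E].
Qed.

Lemma C2_on_laplacian_at U f x :
  open U -> C2_on U f -> U x -> laplacian_at f x (laplacian f x).
Proof.
case: x => a b; move=> oU [f1 f11 f22] Ux.
have nU : \forall y \near (a, b), U y by exact: open_nbhs_nbhs.
exists ('D_e1 ('D_e1 f) (a, b)), ('D_e2 ('D_e2 f) (a, b)); split => //.
- exists (fun t => 'D_e1 f (t, b)); split => /=.
    have := near_section1 nU; apply: filterS => t /= /f1[D _ _ _].
    exact/is_derive_section1/derivableP.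
  rewrite /=; apply/(is_derive_section1 ('D_e1 f) a b); have [D _ _ _] := f11 _ Ux;
    exact/derivableP.
- exists (fun t => 'D_e2 f (a, t)); split => /=.
    have := near_section2 nU; apply: filterS => t /= /f1[_ D _ _].
    exact/is_derive_section2/derivableP.
  rewrite /=; apply/(is_derive_section2 ('D_e2 f) a b); have [_ D _ _] := f22 _ Ux;
    exact/derivableP.
Qed.

Lemma laplacian_at_max f x l :
  (\forall y \near x, f y <= f x) -> laplacian_at f x l -> l <= 0.
Proof.
case: x => a b fx [l1 [l2 [f1 f2 ->]]].
have l10 := derive2_at_max (near_section1 fx) f1.
by have l20 := derive2_at_max (near_section2 fx) f2; rewrite -(addr0 0) lerD.
Qed.

(* Only the majorant [f] has to be continuous up to the boundary of [D]: where [v] is at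
   least [v x0] so is [f], and this keeps the maximum away from the points where [v] may be
   singular. *)
Lemma max_attained (D : set (R * R)) f v x0 :
  compact D -> {within D, continuous f} -> (forall x, D x -> v x <= f x) ->
  (forall x, D x -> 0 < f x -> {for x, continuous v}) -> D x0 -> 0 < v x0 ->
  exists x1, [/\ D x1, v x0 <= v x1 & forall y, D y -> v y <= v x1].
Proof.
move=> cD cf vf cv Dx0 vx0.
pose D' := D `&` [set x | v x0 <= f x].
have D'x0 : D' x0 by split => //; exact: vf.
have cD' : compact D'.
  have : closed ((f @^-1` [set t | v x0 <= t]) : set (subspace D)).
    by apply: closed_comp; [move=> x _; exact: cf|exact: closed_ge].
  move=> /closed_subspaceP[V cV VD].
  have -> : D' = D `&` V by rewrite [RHS]setIC VD setIC.
  exact: compact_closedI.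
have cv' : {within D', continuous v}.
  apply: continuous_in_subspaceT => x /set_mem[Dx vfx].
  by apply: cv => //; exact: lt_le_trans vfx.
have [x1 /set_mem[Dx1 /= fx1] max1] := compact_EVT_max (ex_intro _ x0 D'x0) cD' cv'.
have v01 : v x0 <= v x1 by apply: max1; exact/mem_set.
exists x1; split => // y Dy; have [fy|fy] := leP (v x0) (f y).
  by apply: max1; apply/mem_set.
by apply: le_trans (vf _ Dy) _; exact: le_trans (ltW fy) v01.
Qed.

(** A positive maximum would sit at an interior point, where the Laplacian would be both positive
    and at most 0. The sign condition is asked only where [v] is positive, which is where nonlinear
    terms can be compared. *)
Lemma maximum_principle (D : set (R * R)) f v :
  compact D -> {within D, continuous f} -> (forall x, D x -> v x <= f x) ->
  (forall x, D x -> 0 < f x -> {for x, continuous v}) ->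
  (forall x, D x -> 0 < v x -> nbhs x D /\ exists2 l, 0 < l & laplacian_at v x l) ->
  forall x, D x -> v x <= 0.
Proof.
move=> cD cf vf cv pv x0 Dx0; rewrite leNgt; apply/negP => vx0.
have [x1 [Dx1 v01 max1]] := max_attained cD cf vf cv Dx0 vx0.
have [nD [l l0 vl]] := pv _ Dx1 (lt_le_trans vx0 v01).
suff : l <= 0 by rewrite leNgt l0.
by apply: laplacian_at_max vl; apply: filterS nD => y; exact: max1.
Qed.

Lemma compact_box (F : set (R * R)) (c : R) : closed F ->
  compact ((`[0, c] `*` `[0, c]) `&` F).
Proof.
by move=> cF; apply: compact_closedI => //; apply: compact_setX; exact: segment_compact.
Qed.

End LaplacianAt.

(** * Homogeneous functions on the quadrant *)

Section Jet.
Context {R : realType}.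
Implicit Types (f g U F : R -> R) (a c p : R).

(** Refines [derive2_at] by the value [d1] of the first derivative, which enters the second
    derivative of products and compositions. *)
Definition jet2 g a d1 d2 : Prop := exists g' : R -> R,
  [/\ \forall t \near a, is_derive (t : R) (1 : R) g (g' t),
      is_derive a (1 : R) g' d2 & g' a = d1].

Lemma jet2_derive2_at g a d1 d2 : jet2 g a d1 d2 -> derive2_at g a d2.
Proof. by move=> [g' [gg' g'd _]]; exists g'. Qed.

Lemma jet2M f g a d1 d2 e1 e2 : jet2 f a d1 d2 -> jet2 g a e1 e2 ->
  jet2 (fun t => f t * g t) a (d1 * g a + f a * e1)
    (d2 * g a + 2 * d1 * e1 + f a * e2).
Proof.
move=> [f' [f1 f2 fd]] [g' [g1 g2 gd]].
exists (fun t => f' t * g t + f t * g' t); split.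
- near=> t.
  have fD : is_derive (t : R) (1 : R) f (f' t) by near: t.
  have gD : is_derive (t : R) (1 : R) g (g' t) by near: t.
  by apply: is_derive_eq (is_deriveM fD gD) _; rewrite /GRing.scale/=; ring.
- have fD := nbhs_singleton f1; have gD := nbhs_singleton g1.
  apply: is_derive_eq (is_deriveD (is_deriveM f2 gD) (is_deriveM fD g2)) _.
  by rewrite /GRing.scale/= fd gd; ring.
- by rewrite fd gd.
Unshelve. all: by end_near. Qed.

Lemma jet2_comp F U a d1 d2 e1 e2 : jet2 U a d1 d2 -> jet2 F (U a) e1 e2 ->
  jet2 (fun t => F (U t)) a (e1 * d1) (e2 * d1 ^+ 2 + e1 * d2).
Proof.
move=> [u [u1 u2 ud]] [w [w1 w2 wd]].
have UD := nbhs_singleton u1.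
have cU : {for a, continuous U}.
  by apply/differentiable_continuous/derivable1_diffP; case: UD.
exists (fun t => w (U t) * u t); split.
- have wU : \forall t \near a, is_derive (U t) (1 : R) F (w (U t)) by exact: (cU _ w1).
  near=> t.
  have D1 : is_derive (t : R) (1 : R) U (u t) by near: t.
  have D2 : is_derive (U t) (1 : R) F (w (U t)) by near: t.
  exact: is_derive1_comp.
- have D := is_derive1_comp w2 UD.
  apply: is_derive_eq (is_deriveM D u2) _.
  by rewrite /GRing.scale/= ud wd; ring.
- by rewrite ud wd.
Unshelve. all: by end_near. Qed.

Lemma jet2_powR p a : 0 < a ->
  jet2 (@powR R ^~ p) a (p * a `^ (p - 1)) (p * (p - 1) * a `^ (p - 2)).
Proof.
move=> a0; exists (fun t => p * t `^ (p - 1)); split => //.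
- near=> t; apply: is_derive1_powR; near: t; exact: lt_nbhsr.
- apply: is_derive_eq (is_deriveZ p (is_derive1_powR (p - 1) a0)) _.
  by rewrite /GRing.scale/= mulrA -addrA -opprD.
Unshelve. all: by end_near. Qed.

Lemma jet2_ln a : 0 < a -> jet2 (@ln R) a a^-1 (- a ^- 2).
Proof.
move=> a0; exists (fun t => t^-1); split => //.
- near=> t; apply: is_derive1_ln; near: t; exact: lt_nbhsr.
- have Da := @derivable_id R R a 1.
  split; first exact: (derivableV (lt0r_neq0 a0) Da).
  by rewrite (deriveV (lt0r_neq0 a0) Da) derive_id /GRing.scale/= mulr1.
Unshelve. all: by end_near. Qed.

Lemma jet2_affine c d a : jet2 (fun t => c * t + d) a c 0.
Proof.
exists (cst c); split => //; last exact: is_derive_cst.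
apply: (@filterE _ (nbhs a)) => t; have := is_deriveD (is_deriveZ c (is_derive_id (t
  : R) (1 : R))) (is_derive_cst d (t : R) (1 : R)).
by move=> /is_derive_eq; apply; rewrite /GRing.scale/= mulr1 addr0.
Qed.

Lemma jet2_sqrD d a : jet2 (fun t => t ^+ 2 + d) a (2 * a) 2.
Proof.
rewrite (_ : (fun _ => _) = (fun t : R => t) * (fun t : R => t) + cst d); last first.
  by apply/funext => t; rewrite expr2.
exists (fun t => 2 * t); split => //.
  apply: (@filterE _ (nbhs a)) => t.
  have D := is_derive_id (t : R) (1 : R).
  have := is_deriveD (is_deriveM D D) (is_derive_cst d (t : R) (1 : R)).
  by move=> /is_derive_eq; apply; rewrite /GRing.scale/=; ring.
have := is_deriveZ 2 (is_derive_id (a : R) (1 : R)).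
by move=> /is_derive_eq; apply; rewrite /GRing.scale/= mulr1.
Qed.

End Jet.

(** * The functions [mono p b] and their Laplacians *)

Section Monomials.
Context {R : realType}.
Implicit Types (x : R * R) (p b : R).

Definition nsq x : R := x.1 ^+ 2 + x.2 ^+ 2.

(** In polar coordinates on the quadrant this is r^b (sin(2 theta) / 2)^p. *)
Definition mono p b x : R := (x.1 * x.2) `^ p * nsq x `^ (b / 2 - p).

Lemma laplacian_at_mono p b x : Rpp x -> laplacian_at (mono p b) x
  (p * (p - 1) * mono (p - 2) (b - 2) x + (b ^+ 2 - 4 * p ^+ 2) * mono p (b - 2) x).
Proof.
case: x => x y [/= x0 y0].
have N0 : 0 < x ^+ 2 + y ^+ 2 by rewrite addr_gt0// exprn_gt0.
have X0 : 0 < x * y by rewrite mulr_gt0.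
set q := b / 2 - p.
(* The second derivative in [t] with the other coordinate frozen at [c]; by symmetry the same
   formula serves both axes. *)
pose J (c t : R) :=
  p * (p - 1) * c ^+ 2 * (c * t) `^ (p - 2) * (t ^+ 2 + c ^+ 2) `^ q +
  4 * p * q * c * t * (c * t) `^ (p - 1) * (t ^+ 2 + c ^+ 2) `^ (q - 1) +
  (c * t) `^ p * (4 * q * (q - 1) * t ^+ 2 * (t ^+ 2 + c ^+ 2) `^ (q - 2) +
    2 * q * (t ^+ 2 + c ^+ 2) `^ (q - 1)).
have HJ (c t : R) : 0 < c -> 0 < t ->
    derive2_at (fun t => (c * t) `^ p * (t ^+ 2 + c ^+ 2) `^ q) t (J c t).
  move=> c0 t0.
  have A := jet2_affine c 0 t.
  have B := jet2_sqrD (c ^+ 2) t.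
  have X1 : 0 < c * t + 0 by rewrite addr0 mulr_gt0.
  have N1 : 0 < t ^+ 2 + c ^+ 2 by rewrite addr_gt0// exprn_gt0.
  have := jet2M (jet2_comp A (jet2_powR p X1)) (jet2_comp B (jet2_powR q N1)).
  move=> /jet2_derive2_at /=; rewrite !addr0.
  under [X in derive2_at X]funext do rewrite addr0.
  by congr derive2_at; rewrite /J; ring.
exists (J y x), (J x y); split => /=.
- apply: derive2_at_eq (HJ _ _ y0 x0) => t; rewrite /mono/= (mulrC y) //.
- apply: derive2_at_eq (HJ _ _ x0 y0) => t; rewrite /mono/nsq/= (addrC (t ^+ 2)) //.
- rewrite /J /mono /nsq/= (mulrC y x) (addrC (y ^+ 2)).
  (* All exponents become [p - 2] or [q - 2] plus a number of ones; pulling out these factors leaves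
     a polynomial identity. *)
  have -> : (b - 2) / 2 - (p - 2) = q - 2 + 1 + 1 + 1 by rewrite /q; field.
  have -> : (b - 2) / 2 - p = q - 2 + 1 by rewrite /q; field.
  have -> : p - 1 = p - 2 + 1 by ring.
  have -> : q - 1 = q - 2 + 1 by ring.
  have -> : b ^+ 2 - 4 * p ^+ 2 = 8 * p * q + 4 * q ^+ 2 by rewrite /q; field.
  have powS (z : R) r : 0 < z -> z `^ (r + 1) = z * z `^ r.
    by move=> z0; rewrite powRD ?(gt_eqF z0) ?implybT// powRr1 ?ltW// mulrC.
  have -> : (x * y) `^ p = (x * y) `^ (p - 2 + 1 + 1) by congr powR; ring.
  have -> : (x ^+ 2 + y ^+ 2) `^ q = (x ^+ 2 + y ^+ 2) `^ (q - 2 + 1 + 1).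
    by congr powR; ring.
  rewrite !powS//; ring.
Qed.

(** The factor [x.1 * x.2] is harmonic, so there remain the cross term of the gradients and the
    product with the Laplacian of the logarithm. *)
Lemma laplacian_at_xy_ln eta x : 0 < eta ->
  laplacian_at (fun x => x.1 * x.2 * ln (nsq x + eta)) x
    (8 * (x.1 * x.2) / (nsq x + eta) + 4 * eta * (x.1 * x.2) / (nsq x + eta) ^+ 2).
Proof.
case: x => x y eta0 /=.
pose J (c t : R) :=
  2 * c * (2 * t / (t ^+ 2 + (c ^+ 2 + eta))) +
  (c * t) * (- (t ^+ 2 + (c ^+ 2 + eta)) ^- 2 * (2 * t) ^+ 2 + 2 / (t ^+ 2 + (c ^+ 2 +
    eta))).
have HJ (c t : R) :
    derive2_at (fun t => (c * t) * ln (t ^+ 2 + (c ^+ 2 + eta))) t (J c t).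
  have A := jet2_affine c 0 t.
  have B := jet2_sqrD (c ^+ 2 + eta) t.
  have N1 : 0 < t ^+ 2 + (c ^+ 2 + eta) by rewrite addrA ltr_wpDl// addr_ge0// sqr_ge0.
  have := jet2M A (jet2_comp B (jet2_ln N1)).
  move=> /jet2_derive2_at /=; rewrite !addr0.
  under [X in derive2_at X]funext do rewrite addr0.
  by congr derive2_at; rewrite /J; ring.
have N1 : 0 < x ^+ 2 + y ^+ 2 + eta by rewrite ltr_wpDl// addr_ge0// sqr_ge0.
exists (J y x), (J x y); split => /=.
- apply: derive2_at_eq (HJ _ _) => t; rewrite /nsq/= (mulrC y) addrA//.
- apply: derive2_at_eq (HJ _ _) => t; rewrite /nsq/= addrA (addrC (t ^+ 2)) //.
- rewrite /J /nsq/= !addrA (addrC (y ^+ 2)).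
  by field; rewrite gt_eqF.
Qed.

End Monomials.

Section MonomialTheory.
Context {R : realType}.
Implicit Types (x : R * R) (p b l : R).

Lemma powR_continuous_at p (a : R) : 0 < a -> {for a, continuous (@powR R ^~ p)}.
Proof.
move=> a0; apply/differentiable_continuous/derivable1_diffP.
by have [] := is_derive1_powR p a0.
Qed.

Lemma fst_continuous_at x : {for x, continuous (fst : R * R -> R)}.
Proof. exact: cvg_fst. Qed.

Lemma snd_continuous_at x : {for x, continuous (snd : R * R -> R)}.
Proof. exact: cvg_snd. Qed.

Lemma nsq_continuous : continuous (@nsq R).
Proof.
move=> x; rewrite /continuous_at /nsq.
by apply: cvgD; rewrite expr2; apply: (@cvgM _ _ (nbhs x));
  first [exact: cvg_fst|exact: cvg_snd].
Qed.

Lemma xy_continuous : continuous (fun x : R * R => x.1 * x.2).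
Proof. by move=> x; apply: (@cvgM _ _ (nbhs x)); [exact: cvg_fst|exact: cvg_snd]. Qed.

Lemma nsq_ge0 x : 0 <= nsq x.
Proof. by rewrite addr_ge0// sqr_ge0. Qed.

Lemma nsq_gt0 x : Rpp x -> 0 < nsq x.
Proof. by move=> [x0 y0]; rewrite addr_gt0// exprn_gt0. Qed.

Lemma xy_le_nsq x : x.1 * x.2 <= nsq x / 2.
Proof. by have := sqr_ge0 (x.1 - x.2); rewrite /nsq; nra. Qed.

Lemma open_Rpp : open (@Rpp R).
Proof.
have -> : @Rpp R = (fst @^-1` [set t | 0 < t]) `&` (snd @^-1` [set t | 0 < t]) by [].
apply: openI; apply: open_comp; try exact: open_gt.
- by move=> x _; exact: fst_continuous_at.
- by move=> x _; exact: snd_continuous_at.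
Qed.

Lemma mono_continuous p b x : Rpp x -> {for x, continuous (mono p b)}.
Proof.
move=> xp; have [x0 y0] := xp; apply: (@cvgM _ _ (nbhs x)).
  apply: (continuous_comp (f := fun x => x.1 * x.2) (g := @powR R ^~ p)).
    exact: xy_continuous.
  by apply: powR_continuous_at; rewrite mulr_gt0.
apply: (continuous_comp (g := @powR R ^~ _)).
  exact: nsq_continuous.
exact/powR_continuous_at/nsq_gt0.
Qed.

Lemma mono_ge0 p b x : 0 <= mono p b x.
Proof. by rewrite mulr_ge0// powR_ge0. Qed.

Lemma mono_gt0 p b x : Rpp x -> 0 < mono p b x.
Proof.
move=> xp; have [x0 y0] := xp; apply: mulr_gt0; apply: powR_gt0; last exact: nsq_gt0.
exact: mulr_gt0.
Qed.

(** At fixed degree, [mono r b x] is a factor independent of [r] times the [r]-th power of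
    [x.1 * x.2 / nsq x], a number in []0, 1]]. *)
Lemma mono_le p q b x : Rpp x -> q <= p -> mono p b x <= mono q b x.
Proof.
move=> xp qp; have [x0 y0] := xp; have N0 := nsq_gt0 xp.
have X0 : 0 < x.1 * x.2 by rewrite mulr_gt0.
have E r : mono r b x = ((x.1 * x.2) / nsq x) `^ r * nsq x `^ (b / 2).
  rewrite /mono [in RHS]powRM ?invr_ge0 ?ltW// -mulrA; congr (_ * _).
  rewrite -(powR_inv1 (ltW N0)) -powRrM -powRD ?(gt_eqF N0) ?implybT//.
  by congr powR; ring.
rewrite !E ler_wpM2r ?powR_ge0//; apply: ger_powR => //.
rewrite divr_gt0//= ler_pdivrMr// mul1r.
by have := xy_le_nsq x; lra.
Qed.

Lemma mono_homogeneous p b x l : 0 < l -> Rpp x ->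
  mono p b (l * x.1, l * x.2) = l `^ b * mono p b x.
Proof.
move=> l0 xp; have [x0 y0] := xp; have N0 := nsq_gt0 xp.
have X0 : 0 < x.1 * x.2 by rewrite mulr_gt0.
have l2 : 0 < l ^+ 2 by rewrite exprn_gt0.
rewrite /mono/= (_ : nsq (l * x.1, l * x.2) = l ^+ 2 * nsq x); last first.
  by rewrite /nsq/=; ring.
rewrite (_ : l * x.1 * (l * x.2) = l ^+ 2 * (x.1 * x.2)); last by ring.
rewrite (powRM _ (ltW l2) (ltW X0)) (powRM _ (ltW l2) (ltW N0)) mulrACA.
congr (_ * _); rewrite -powRD ?(gt_eqF l2) ?implybT//.
rewrite -(powR_mulrn 2 (ltW l0)) -powRrM.
by congr powR; field.
Qed.

Lemma mono_powR p b x r : Rpp x -> mono p b x `^ r = mono (p * r) (b * r) x.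
Proof.
by move=> xp; rewrite powRM ?powR_ge0// -!powRrM; congr (_ * _ `^ _); field.
Qed.

Lemma mono1 b x : Rpp x -> mono 1 b x = x.1 * x.2 * nsq x `^ (b / 2 - 1).
Proof. by move=> [x0 y0]; rewrite /mono powRr1// mulr_ge0// ltW. Qed.

Lemma mono0 b x : mono 0 b x = nsq x `^ (b / 2).
Proof. by rewrite /mono powRr0 mul1r subr0. Qed.

End MonomialTheory.

Section Cone.
Context {R : realType}.
Implicit Types (x : R * R).

Definition quarter_circle : set (R * R) := [set x | [/\ 0 <= x.1, 0 <= x.2 & nsq x = 1]].

Lemma compact_quarter_circle : compact quarter_circle.
Proof.
have -> : quarter_circle = (`[0, 1] `*` `[0, 1]) `&` (@nsq R @^-1` [set 1]).
  apply/seteqP; split=> [[x y] [/= x0 y0 N1]|[x y] [[/=]]].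
    split => //; split => /=; rewrite in_itv/= ?x0 ?y0/=.
      by move: N1; rewrite /nsq/=; nra.
    by move: N1; rewrite /nsq/=; nra.
  by rewrite !in_itv/= => /andP[x0 _] /andP[y0 _].
apply: compact_box; apply: closed_comp; last exact: closed_eq.
by move=> x _; exact: nsq_continuous.
Qed.

(* [P] below is positively homogeneous of degree [a], superharmonic because [a < 2], and
   bounded away from 0 on the quarter circle; a maximum of [v / P] on the quarter circle is
   a maximum on the whole cone, where [v - m P] has a positive Laplacian. *)
Lemma cone_comparison (a : R) (f v : R * R -> R) : 0 < a < 2 ->
  {within quarter_circle, continuous f} -> (forall x, quarter_circle x -> 0 <= f x) ->
  (forall x, quarter_circle x -> 0 < f x -> Rpp x) ->
  (forall x, quarter_circle x -> v x <= f x) ->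
  (forall x, Rpp x -> {for x, continuous v}) ->
  (forall (l : R) x, 0 < l -> Rpp x -> v (l * x.1, l * x.2) = l `^ a * v x) ->
  (forall x, Rpp x -> 0 < v x -> exists2 l, 0 < l & laplacian_at v x l) ->
  forall x, Rpp x -> v x <= 0.
Proof.
move=> /andP[a0 a2] cf f0 fpp vf cv hv lv x xp.
(* [g] is the midpoint of [a / 2] and 1: [g < 1] makes the leading term of the Laplacian of
   [mono g a] negative, [a < 2 * g] makes the other one negative. [d] is such that [d * a ^+ 2],
   produced by [mono 0 a], is exactly absorbed. *)
pose g := (1 + a / 2) / 2; pose d := g * (1 - g) / a ^+ 2.
have g1 : g < 1 by rewrite /g; lra.
have g0 : 0 < g by rewrite /g; lra.
have ga : a < 2 * g by rewrite /g; lra.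
have d0 : 0 < d by rewrite divr_gt0 ?exprn_gt0// mulr_gt0// subr_gt0.
pose P (y : R * R) := mono g a y + d * mono 0 a y.
have lP y : Rpp y -> exists2 l, l <= 0 & laplacian_at P y l.
  move=> yp; eexists; last first.
    apply: laplacian_atD; first exact: laplacian_at_mono.
    exact/laplacian_atZ/laplacian_at_mono.
  have m1 := @mono_le R 0 (g - 2) (a - 2) y yp.
  have {}m1 : mono 0 (a - 2) y <= mono (g - 2) (a - 2) y by apply: m1; lra.
  have m0 := mono_gt0 0 (a - 2) yp.
  have mg := mono_gt0 g (a - 2) yp.
  have : d * a ^+ 2 = g * (1 - g) by rewrite /d divfK// expf_neq0// gt_eqF.
  move: m1 m0 mg; set m0 := mono 0 _ _; set m1 := mono (g - 2) _ _; set m2 := mono g _ _.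
  move=> m01 m0p m2p dE.
  have -> : d * (0 * (0 - 1) * mono (0 - 2) (a - 2) y + (a ^+ 2 - 4 * 0 ^+ 2) * m0) =
     g * (1 - g) * m0 by rewrite -dE; ring.
  have : g * (1 - g) * m0 <= g * (1 - g) * m1.
    by rewrite ler_pM2l// mulr_gt0// subr_gt0.
  have : 0 <= (4 * g ^+ 2 - a ^+ 2) * m2 by apply: mulr_ge0; [nra|exact: ltW].
  lra.
have P0 y : Rpp y -> 0 < P y.
  by move=> yp; apply: addr_gt0; [|apply: mulr_gt0 => //]; exact: mono_gt0.
have Pd y : quarter_circle y -> d <= P y.
  move=> [_ _ N1]; rewrite /P mono0 N1 powR1 mulr1 lerDr; exact: mono_ge0.
have hP (l : R) y : 0 < l -> Rpp y -> P (l * y.1, l * y.2) = l `^ a * P y.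
  by move=> l0 yp; rewrite /P !mono_homogeneous//; ring.
pose w y := v y / P y.
rewrite leNgt; apply/negP => vx.
have onarc y : Rpp y -> exists l z, [/\ 0 < l, quarter_circle z, Rpp z & y = (l * z.1,
  l * z.2)].
  move=> yp; have N0 := nsq_gt0 yp; have [y1 y2] := yp.
  have S0 : 0 < Num.sqrt (nsq y) by rewrite sqrtr_gt0.
  have S0' := lt0r_neq0 S0.
  exists (Num.sqrt (nsq y)), (y.1 / Num.sqrt (nsq y), y.2 / Num.sqrt (nsq y)).
  split => //=.
  - split => /=; rewrite ?divr_ge0 ?ltW//.
    rewrite /nsq/= !expr_div_n sqr_sqrtr ?ltW// -mulrDl divff// gt_eqF//.
  - by split; rewrite /= divr_gt0.
  - by rewrite ![_ * (_ / _)]mulrC !divfK//; case: y {yp N0 y1 y2 S0 S0'}.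
have [l0 [z0 [l0p az0 z0p xE]]] := onarc _ xp.
have vz0 : 0 < v z0.
  by move: vx; rewrite xE hv// pmulr_rgt0// powR_gt0.
have [z1 [az1 w01 wmax]] : exists x1, [/\ quarter_circle x1, w z0 <= w x1 & forall y,
  quarter_circle y -> w y <= w x1].
  (* Since [P >= d] on the quarter circle, [f / d] dominates [v / P], and it is continuous up to the
     axes. *)
  apply: (@max_attained _ _ (fun y => f y / d)) => //.
  - exact: compact_quarter_circle.
  - move=> y; apply: (@cvgM _ (subspace quarter_circle)); first exact: cf.
    exact: cvg_cst.
  - move=> y ay; have Py := Pd _ ay; have fy := f0 _ ay.
    have Py0 : 0 < P y := lt_le_trans d0 Py.
    rewrite ler_pdivrMr// mulrAC ler_pdivlMr//.
    by have := vf _ ay; nra.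
  - move=> y ay; rewrite pmulr_lgt0 ?invr_gt0// => /(fpp _ ay) yp.
    apply: (@cvgM _ _ (nbhs y)); first exact: cv.
    apply: cvgV; first exact: lt0r_neq0 (P0 _ yp).
    apply: (@cvgD _ _ _ (nbhs y)); first exact: mono_continuous.
    apply: (@cvgM _ _ (nbhs y)); first exact: cvg_cst.
    exact: mono_continuous.
  - by rewrite divr_gt0// P0.
pose m := w z1.
have m0 : 0 < m by apply: lt_le_trans w01; rewrite divr_gt0// P0.
have Pz1 : 0 < P z1 := lt_le_trans d0 (Pd _ az1).
have vz1 : v z1 = m * P z1 by rewrite /m /w divfK// gt_eqF.
have vz1p : 0 < v z1 by rewrite vz1 mulr_gt0.
have z1p : Rpp z1 by apply: fpp => //; exact: lt_le_trans (vf _ az1).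
have vmax y : Rpp y -> v y <= m * P y.
  move=> yp; have [l [z [lp az zp ->]]] := onarc _ yp.
  rewrite hv// hP// mulrCA ler_pM2l ?powR_gt0//.
  by rewrite -ler_pdivrMr ?P0//; exact: wmax.
have [k k0 vk] := lv _ z1p vz1p; have [h h0 Ph] := lP _ z1p.
have : k - m * h <= 0.
  apply: laplacian_at_max (laplacian_atB vk (laplacian_atZ m Ph)).
  have : \forall y \near z1, Rpp y by apply: open_nbhs_nbhs; split => //; exact: open_Rpp.
  by apply: filterS => y yp; rewrite vz1 subrr subr_le0 vmax.
by nra.
Qed.

End Cone.

(** * The barrier function *)

Section C1Continuity.
Context {R : realType}.
Implicit Types (f : R * R -> R).

(** Continuous partial derivatives are bounded near the point; the mean value theorem along a
    horizontal and then a vertical segment gives a local Lipschitz bound. *)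
Lemma C1_on_continuous (U : set (R * R)) f :
  open U -> C1_on U f -> forall x, U x -> {for x, continuous f}.
Proof.
move=> oU C1 [a b] Uab.
have [g1 [D1 c1]] : exists g : R * R -> R,
    (forall y, U y -> is_derive y (e1 : R * R) f (g y)) /\ {for (a, b), continuous g}.
  exists ('D_e1 f); split; last by have [_ _ c _] := C1 _ Uab; exact: c.
  by move=> y /C1[D _ _ _]; exact/derivableP.
have [g2 [D2 c2]] : exists g : R * R -> R,
    (forall y, U y -> is_derive y (e2 : R * R) f (g y)) /\ {for (a, b), continuous g}.
  exists ('D_e2 f); split; last by have [_ _ _ c] := C1 _ Uab; exact: c.
  by move=> y /C1[_ D _ _]; exact/derivableP.
pose M := `|g1 (a, b)| + `|g2 (a, b)| + 1.
have M0 : 0 < M by rewrite ltr_wpDl// addr_ge0.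
have [e /= e0 He] : exists2 e : R, 0 < e & forall s t, `|s - a| < e -> `|t - b| < e ->
    [/\ U (s, t), `|g1 (s, t)| <= M & `|g2 (s, t)| <= M].
  have : \forall y \near (a, b), [/\ U y, `|g1 y| <= M & `|g2 y| <= M].
    have nU : \forall y \near (a, b), U y by exact: open_nbhs_nbhs.
    have n1 : \forall y \near (a, b), `|g1 y| < M.
      by apply: (cvgr_norm_lt _ c1); rewrite /M; have := normr_ge0 (g2 (a, b)); lra.
    have n2 : \forall y \near (a, b), `|g2 y| < M.
      by apply: (cvgr_norm_lt _ c2); rewrite /M; have := normr_ge0 (g1 (a, b)); lra.
    by apply: filterS3 nU n1 n2 => y Uy /ltW y1 /ltW y2.
  move=> /nbhs_ballP[e e0 H]; exists e => // s t sa tb.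
  by apply: H; split; rewrite /= /ball/= distrC.
have lip (g dg : R -> R) (c u w : R) : (forall t,
  `|t - c| < e -> is_derive t (1 : R) g (dg t)) ->
    (forall t, `|t - c| < e -> `|dg t| <= M) -> `|u - c| < e -> `|w - c| < e -> u <= w ->
    `|g w - g u| <= M * `|w - u|.
  move=> gD gM uc wc uw.
  have ball_t t : u <= t <= w -> `|t - c| < e.
    by move: uc wc; rewrite !ltr_norml => /andP[? ?] /andP[? ?] /andP[? ?]; lra.
  have [||z] := @MVT_segment _ g dg u w uw.
  - by move=> t; rewrite in_itv/= => /andP[t1 t2]; apply/gD/ball_t; rewrite !ltW.
  - apply: derivable_within_continuous => t; rewrite in_itv/= => tuw.
    by have [] := gD t (ball_t t tuw).
  - rewrite in_itv/= => zuw ->; rewrite normrM ler_wpM2r//.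
    exact/gM/ball_t.
have lip' (g dg : R -> R) (c u w : R) : (forall t,
  `|t - c| < e -> is_derive t (1 : R) g (dg t)) ->
    (forall t, `|t - c| < e -> `|dg t| <= M) -> `|u - c| < e -> `|w - c| < e ->
    `|g w - g u| <= M * `|w - u|.
  move=> gD gM uc wc; have [uw|/ltW uw] := leP u w; first exact: (lip g dg c).
  by rewrite distrC (distrC w); exact: (lip g dg c).
apply/cvgrPdist_le => d d0.
suff : \forall y \near (a, b), `|f (a, b) - f y| <= d by [].
(* With this radius each of the two segments contributes at most [d / 2]. *)
have ed : 0 < Num.min e (d / (2 * M)) by rewrite lt_min e0/= divr_gt0// mulr_gt0.
apply/nbhs_ballP; exists (Num.min e (d / (2 * M))) => //= -[s t] [/=].
rewrite /ball/= !lt_min => /andP[sa sd] /andP[tb td].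
have sa' : `|s - a| < e by rewrite distrC.
have tb' : `|t - b| < e by rewrite distrC.
have aa : `|a - a| < e by rewrite subrr normr0.
have bb : `|b - b| < e by rewrite subrr normr0.
have L1 : `|f (a, t) - f (s, t)| <= M * `|a - s|.
  apply: (lip' (fun s => f (s, t)) (fun s => g1 (s, t)) a) => // r ra.
    by have [Ur _ _] := He _ _ ra tb'; exact/(is_derive_section1 f r t)/D1.
  by have [] := He _ _ ra tb'.
have L2 : `|f (a, b) - f (a, t)| <= M * `|b - t|.
  apply: (lip' (fun s => f (a, s)) (fun s => g2 (a, s)) b) => // r rb.
    by have [Ur _ _] := He _ _ aa rb; exact/(is_derive_section2 f a r)/D2.
  by have [] := He _ _ aa rb.
rewrite -(subrKA (f (a, t))); apply: le_trans (ler_normD _ _) _.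
have k : M * (d / (2 * M)) = d / 2 by field; rewrite gt_eqF.
have : M * `|a - s| <= d / 2 by rewrite -k ler_pM2l// ltW.
have : M * `|b - t| <= d / 2 by rewrite -k ler_pM2l// ltW.
lra.
Unshelve. all: by end_near. Qed.

End C1Continuity.

(** * Two-sided bounds for the barrier *)

Section Barrier.
Context {R : realType}.
Implicit Types (x : R * R) (s eps : R) (Psi : R * R -> R).

Lemma barrier_quarter_circle s eps Psi : is_barrier s eps Psi ->
  [/\ {within quarter_circle, continuous Psi}, forall x, quarter_circle x -> 0 <= Psi x &
      forall x, quarter_circle x -> 0 < Psi x -> Rpp x].
Proof.
move=> [Pp _ Pc _ _ Pb _ _]; split.
- by apply: continuous_subspaceW Pc => x [].
- move=> x [x1 x2 _]; have [/Pp/ltW//|nx] := pselect (Rpp x).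
  by rewrite Pb.
- move=> x [x1 x2 _] Px; have [//|nx] := pselect (Rpp x).
  by move: Px; rewrite Pb ?ltxx.
Qed.

Lemma barrier_laplacian_at s eps Psi x : is_barrier s eps Psi -> Rpp x ->
  laplacian_at Psi x (- (eps `^ s * Psi x `^ (- s))).
Proof.
move=> [_ _ _ PC2 Peq _ _ _] xp; rewrite -Peq//.
exact: C2_on_laplacian_at open_Rpp PC2 xp.
Qed.

Lemma barrier_continuous_at s eps Psi x : is_barrier s eps Psi -> Rpp x ->
  {for x, continuous Psi}.
Proof. by move=> [_ _ _ [PC1 _ _] _ _ _ _] xp; exact: (C1_on_continuous open_Rpp PC1). Qed.

(** A small multiple of [mono 1 al] is a subsolution: where it exceeds [Psi], the decreasing power
    [- s] makes [- Delta Psi] the larger of the two. *)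
Lemma barrier_ge s eps Psi x : 0 < s < 1 -> 0 < eps -> is_barrier s eps Psi -> Rpp x ->
  4^-1 * eps `^ (s / (1 + s)) * mono 1 (2 / (1 + s)) x <= Psi x.
Proof.
move=> /andP[s0 s1] e0 hP xp; set al := 2 / (1 + s); set E := eps `^ _.
have s10 : 1 + s != 0 by rewrite gt_eqF// addr_gt0.
have E0 : 0 < E by exact: powR_gt0.
have Ees : E `^ (1 + s) = eps `^ s by rewrite -powRrM divfK.
have [_ Ppos Ppp] := barrier_quarter_circle hP.
have Pp := barrier_gt0 hP; have Ph := barrier_homogeneous hP.
have al2 : al < 2 by rewrite ltr_pdivrMr; lra.
have al0 : 0 < al by rewrite divr_gt0// addr_gt0.
have als : al * (1 + s) = 2 by rewrite /al divfK.
pose c := 4^-1 * E; have c0 : 0 < c by rewrite mulr_gt0.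
(* The factor 1/4 in [c] is raised to the power [1 + s >= 1], so it compensates the 4 coming from
   the Laplacian of [mono 1 al]. *)
have cs : 4 * c `^ (1 + s) <= eps `^ s.
  have h4 : 0 <= (4^-1 : R) by rewrite invr_ge0.
  rewrite /c (powRM _ h4 (ltW E0)) Ees mulrA ler_piMl ?powR_ge0//.
  have : (4^-1 : R) `^ (1 + s) <= 4^-1.
    have h : 0 < (4^-1 : R) <= 1 by lra.
    by apply: ge1r_powR => //; lra.
  lra.
rewrite -subr_le0.
(* On the quarter circle [mono 1 al] equals [x.1 * x.2], which is continuous and vanishes on the
   axes. *)
apply: (@cone_comparison _ al (fun x => c * (x.1 * x.2)) (fun x => c * mono 1 al x - Psi
  x)) => //.
- exact/andP.
- apply: continuous_subspaceT => y.
  by apply: (@cvgM _ _ (nbhs y)); [exact: cvg_cst|exact: xy_continuous].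
- by move=> y [y1 y2 _]; apply: mulr_ge0; [exact: ltW|exact: mulr_ge0].
- move=> y [y1 y2 _]; rewrite pmulr_rgt0// => y12.
  by split; rewrite lt_neqAle eq_sym; apply/andP; split => //; apply/eqP => y0;
     rewrite y0 ?mul0r ?mulr0 ltxx in y12.
- move=> y ay; have [y1 y2 N1] := ay.
  rewrite /mono N1 powR1 mulr1 powRr1 ?mulr_ge0//.
  by rewrite gerBl; exact: Ppos.
- move=> y yp; apply: (@cvgD _ _ _ (nbhs y)).
    by apply: (@cvgM _ _ (nbhs y)); [exact: cvg_cst|exact: mono_continuous].
  by apply: cvgN; exact: barrier_continuous_at hP yp.
- by move=> l y l0 yp; rewrite mono_homogeneous// Ph//; ring.
- move=> y yp; rewrite subr_gt0 => Py.
  eexists; last first.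
    apply: laplacian_atB; first exact/laplacian_atZ/laplacian_at_mono.
    exact: barrier_laplacian_at hP yp.
  have m1 := mono_gt0 1 (al - 2) yp.
  have Py0 := Pp _ yp.
  have V0 : 0 < c * mono 1 al y by rewrite mulr_gt0// mono_gt0.
  have : c * 4 * mono 1 (al - 2) y <= eps `^ s * Psi y `^ (- s).
    apply: (@le_trans _ _ (eps `^ s * (c * mono 1 al y) `^ (- s))); last first.
      rewrite ler_wpM2l ?powR_ge0// !powRN lef_pV2 ?posrE ?powR_gt0//.
      by apply: ge0_ler_powR; rewrite ?nnegrE ?ltW.
    rewrite (powRM _ (ltW c0)) ?mono_ge0// mono_powR// mul1r mulrA.
    (* From [al * (1 + s) = 2]: the power [- s] of a function of degree [al] has the degree of its
       Laplacian. *)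
    rewrite (_ : al * - s = al - 2); last by lra.
    apply: ler_pM; [by rewrite mulr_ge0// ltW|exact: mono_ge0| |by apply: mono_le => //;
      lra].
    rewrite powRN ler_pdivlMr ?powR_gt0// mulrAC mulrC.
    by move: cs; rewrite powRD ?(gt_eqF c0) ?implybT// (powRr1 (ltW c0)); lra.
  have am : 0 < al ^+ 2 * mono 1 (al - 2) y * c by apply: mulr_gt0 => //;
    apply: mulr_gt0 => //; exact: exprn_gt0.
  lra.
Qed.

(** The supersolution is a multiple of [A mono 1 al - mono p al] with [p = 2 - s]: the Laplacian of
    [mono p al] contains [mono (- s) (al - 2)], exactly the singularity of the right-hand side at
    the axes. [C] depends on [s] alone. *)
Lemma barrier_le s : 0 < s < 1 -> exists2 C : R, 0 < C &
  forall eps Psi x, 0 < eps -> is_barrier s eps Psi -> Rpp x ->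
  Psi x <= C * eps `^ (s / (1 + s)) * mono 1 (2 / (1 + s)) x.
Proof.
move=> /andP[s0 s1]; set al := 2 / (1 + s).
have s10 : 1 + s != 0 by rewrite gt_eqF// addr_gt0.
have al2 : al < 2 by rewrite ltr_pdivrMr; lra.
have al0 : 0 < al by rewrite divr_gt0// addr_gt0.
have als : al * (1 + s) = 2 by rewrite /al divfK.
have al4 : 0 < 4 - al ^+ 2 by nra.
pose p := 2 - s.
(* The second summand absorbs the remaining term of the Laplacian of [mono p al]; the 2 ensures
   strictness and [A mono 1 al - mono p al >= mono 1 al]. *)
pose A := 2 + 4 * p ^+ 2 / (4 - al ^+ 2).
have A2 : 2 <= A.
  by rewrite lerDl; apply: divr_ge0; [rewrite mulr_ge0// sqr_ge0|exact: ltW].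
have AE : A * (4 - al ^+ 2) = 2 * (4 - al ^+ 2) + 4 * p ^+ 2.
  by rewrite /A; field; rewrite gt_eqF.
have pp : 0 < p * (p - 1) by rewrite /p; nra.
(* Then both [M0] and [M0 * (p * (p - 1))] are at least 1. *)
pose M0 := 1 + (p * (p - 1))^-1.
have M01 : 1 <= M0 by rewrite lerDl invr_ge0 ltW.
have M0s : 1 <= M0 `^ (1 + s) * (p * (p - 1)).
  apply: (@le_trans _ _ (M0 * (p * (p - 1)))).
    by rewrite /M0 mulrDl mulVf ?gt_eqF// mul1r lerDr ltW.
  rewrite ler_pM2r//; apply: le1r_powR => //; lra.
exists (M0 * A); first by nra.
move=> eps Psi x e0 hP xp; set E := eps `^ _.
have E0 : 0 < E by exact: powR_gt0.
have Ees : E `^ (1 + s) = eps `^ s by rewrite -powRrM divfK.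
have [Pc Ppos Ppp] := barrier_quarter_circle hP.
have Pp := barrier_gt0 hP; have Ph := barrier_homogeneous hP.
pose M := M0 * E; have Mgt0 : 0 < M by rewrite mulr_gt0//; lra.
have Ms : eps `^ s <= M `^ (1 + s) * (p * (p - 1)).
  have M00 : 0 <= M0 by lra.
  rewrite /M (powRM _ M00 (ltW E0)) Ees mulrAC ler_pMl ?powR_gt0//.
pose V y := M * (A * mono 1 al y - mono p al y).
have mp y : Rpp y -> mono p al y <= mono 1 al y by move=> yp; apply: mono_le => //;
  rewrite /p; lra.
have V1 y : Rpp y -> M * mono 1 al y <= V y.
  move=> yp; rewrite ler_pM2l//; have := mp y yp; have := mono_gt0 1 al yp; nra.
suff : Psi x - V x <= 0.
  rewrite subr_le0 => /le_trans; apply.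
  rewrite /V (_ : M0 * A * E * mono 1 al x = M * (A * mono 1 al x)).
    by rewrite ler_pM2l// gerBl; exact: mono_ge0.
  by rewrite /M; ring.
apply: (@cone_comparison _ al Psi (fun y => Psi y - V y)) => //.
- exact/andP.
- move=> y ay; rewrite gerBl; apply: mulr_ge0; [exact: ltW|rewrite subr_ge0].
  have [y1 y2 N1] := ay; have [yp|yp] := pselect (Rpp y).
    by have := mp y yp; have := mono_gt0 1 al yp; nra.
  have y12 : y.1 * y.2 = 0.
    apply/eqP; rewrite mulf_eq0; apply/negPn/negP; rewrite negb_or => /andP[z1 z2].
    by apply: yp; split; rewrite lt_neqAle eq_sym ?z1 ?z2.
  (* [powR] takes 0 to 0 at nonzero exponents, so both functions vanish on the axes. *)
  rewrite /mono y12 !powR0 ?mul0r ?mulr0// gt_eqF// /p; lra.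
- move=> y yp; apply: (@cvgD _ _ _ (nbhs y)); first exact: barrier_continuous_at hP yp.
  apply: cvgN; apply: (@cvgM _ _ (nbhs y)); first exact: cvg_cst.
  apply: (@cvgD _ _ _ (nbhs y)).
    by apply: (@cvgM _ _ (nbhs y)); [exact: cvg_cst|exact: mono_continuous].
  by apply: cvgN; exact: mono_continuous.
- by move=> l y l0 yp; rewrite /V !mono_homogeneous// Ph//; ring.
- move=> y yp; rewrite subr_gt0 => Py.
  eexists; last first.
    apply: laplacian_atB; first exact: barrier_laplacian_at hP yp.
    apply: laplacian_atZ; apply: laplacian_atB; last exact: laplacian_at_mono.
    exact/laplacian_atZ/laplacian_at_mono.
  have m1 := mono_gt0 1 (al - 2) yp.
  have m2 : mono p (al - 2) y <= mono 1 (al - 2) y by apply: mono_le => //; rewrite /p; lra.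
  have m3 := mono_gt0 p (al - 2) yp.
  have Py0 := Pp _ yp.
  have V0 : 0 < M * mono 1 al y by rewrite mulr_gt0// mono_gt0.
  have : eps `^ s * Psi y `^ (- s) <= M * (p * (p - 1) * mono (p - 2) (al - 2) y).
    apply: (@le_trans _ _ (eps `^ s * (M * mono 1 al y) `^ (- s))).
      rewrite ler_wpM2l ?powR_ge0// !powRN lef_pV2 ?posrE ?powR_gt0//.
      apply: ge0_ler_powR; [exact: ltW|rewrite nnegrE; exact: ltW|rewrite nnegrE;
        exact: ltW|].
      exact: ltW (le_lt_trans (V1 _ yp) Py).
    rewrite (powRM _ (ltW Mgt0)) ?mono_ge0// mono_powR// mul1r (mulrA (eps `^ s)) (mulrA M
      (p * (p - 1))).
    rewrite (_ : al * - s = al - 2); last by lra.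
    rewrite (_ : p - 2 = - s); last by rewrite /p; ring.
    apply: (@ler_wpM2r _ (mono (- s) (al - 2) y)); first exact: mono_ge0.
    rewrite powRN ler_pdivrMr ?powR_gt0//.
    move: Ms; rewrite powRD ?(gt_eqF Mgt0) ?implybT// (powRr1 (ltW Mgt0)).
    by move=> /le_trans; apply; rewrite le_eqVlt; apply/orP; left; apply/eqP; ring.
  have Am : (4 * p ^+ 2 - al ^+ 2) * mono p (al - 2) y < A * (4 - al ^+ 2) * mono 1 (al -
    2) y.
    rewrite AE; have : 0 <= al ^+ 2 * mono p (al - 2) y by rewrite mulr_ge0 ?sqr_ge0// ltW.
    have : 4 * p ^+ 2 * mono p (al - 2) y <= 4 * p ^+ 2 * mono 1 (al - 2) y.
      by rewrite ler_wpM2l// mulr_ge0// sqr_ge0.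
    have : 0 < 2 * (4 - al ^+ 2) * mono 1 (al - 2) y by apply: mulr_gt0 => //;
      apply: mulr_gt0.
    lra.
  have : 0 < M * (A * (4 - al ^+ 2) * mono 1 (al - 2) y - (4 * p ^+ 2 - al ^+ 2) * mono p
    (al - 2) y).
    by rewrite mulr_gt0// subr_gt0.
  lra.
Qed.

End Barrier.

(** * Comparison for the solution *)

Section Square.
Context {R : realType}.
Implicit Types (x : R * R) (f v u : R * R -> R).

Definition square : set (R * R) := `[0, 2^-1] `*` `[0, 2^-1].

Lemma open_Tpp : open (@Tpp R).
Proof.
have -> : @Tpp R = (fst @^-1` `]0, 2^-1[) `&` (snd @^-1` `]0, 2^-1[).
  by apply/seteqP; split => x /=; rewrite /Tpp/= !in_itv.
apply: openI; apply: open_comp; try exact: interval_open.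
- by move=> x _; exact: fst_continuous_at.
- by move=> x _; exact: snd_continuous_at.
Qed.

Lemma Tpp_Rpp x : Tpp x -> Rpp x.
Proof. by move=> [/andP[? _] /andP[? _]]. Qed.

Lemma Tpp_square x : Tpp x -> square x.
Proof. by move=> [/andP[? ?] /andP[? ?]]; split; rewrite /= in_itv/= !ltW. Qed.

Lemma square_boundary x : square x -> ~ Tpp x ->
  [\/ x.1 = 0, x.2 = 0, x.1 = 2^-1 | x.2 = 2^-1].
Proof.
case: x => x y [/=]; rewrite !in_itv/= => /andP[x0 x1] /andP[y0 y1] nT.
have [xe|xn] := eqVneq x 0; first by constructor 1.
have [ye|yn] := eqVneq y 0; first by constructor 2.
have [xe'|xn'] := eqVneq x 2^-1; first by constructor 3.
have [ye'|yn'] := eqVneq y 2^-1; first by constructor 4.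
by exfalso; apply: nT; split => /=; rewrite !lt_neqAle ?x0 ?x1 ?y0 ?y1 ?xn' ?yn' eq_sym
  ?xn ?yn.
Qed.

(** Oddness gives 0 on the axes; on the sides at 1/2 the values at 1/2 and -1/2 agree by periodicity
    and are opposite by oddness. *)
Lemma odd_periodic_boundary u : biperiodic u ->
  (forall x1 x2 : R, u (x1, x2) = - u (x1, - x2)) ->
  (forall x1 x2 : R, u (x1, x2) = - u (- x1, x2)) ->
  forall x, square x -> ~ Tpp x -> u x = 0.
Proof.
move=> up u2 u1 [x y] sx nx; have [/= ->|/= ->|/= ->|/= ->] := square_boundary sx nx.
- by have := u1 0 y; rewrite oppr0; lra.
- by have := u2 x 0; rewrite oppr0; lra.
- have [+ _] := up (- 2^-1, y); rewrite /e1 /GRing.add/= /add_pair/= addr0.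
  by rewrite (_ : - 2^-1 + 1 = 2^-1); [have := u1 2^-1 y; lra|field].
- have [_] := up (x, - 2^-1); rewrite /e2 /GRing.add/= /add_pair/= addr0.
  by rewrite (_ : - 2^-1 + 1 = 2^-1); [have := u2 x 2^-1; lra|field].
Qed.

(** The majorant [f] is at most 0 on the boundary, so a positive maximum of [v] lies in [Tpp]. *)
Lemma square_comparison f v : continuous f ->
  (forall x, Tpp x -> v x <= f x) ->
  (forall x, square x -> ~ Tpp x -> f x <= 0 /\ v x <= f x) ->
  (forall x, Tpp x -> {for x, continuous v}) ->
  (forall x, Tpp x -> 0 < v x -> exists2 l, 0 < l & laplacian_at v x l) ->
  forall x, Tpp x -> v x <= 0.
Proof.
move=> cf vf bf cv lv x Tx.
have inT y : square y -> 0 < f y -> Tpp y.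
  move=> sy fy; have [//|/(bf _ sy)[]] := pselect (Tpp y).
  by rewrite leNgt fy.
have vf' y : square y -> v y <= f y.
  by move=> sy; have [/vf//|/(bf _ sy)[]] := pselect (Tpp y).
apply: (@maximum_principle _ square f v) (Tpp_square Tx) => //.
- by apply: compact_setX; exact: segment_compact.
- exact: continuous_subspaceT.
- by move=> y sy /(inT _ sy); exact: cv.
- move=> y sy vy; have Ty : Tpp y by apply: inT => //; exact: lt_le_trans (vf' _ sy).
  split; last exact: lv.
  have : \forall z \near y, Tpp z by apply: open_nbhs_nbhs; split => //; exact: open_Tpp.
  by apply: filterS; exact: Tpp_square.
Qed.

End Square.

(** * Bounds for the solution by sub- and supersolutions *)

Section Solution.
Context {R : realType}.
Implicit Types (x : R * R) (s eps : R) (K phi Psi : R * R -> R).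

Lemma solution_continuous K s eps phi : is_solution K s eps phi -> continuous phi.
Proof. by move=> [_ C1 _ _] x; exact: (C1_on_continuous openT C1). Qed.

Lemma solution_boundary K s eps phi x : is_solution K s eps phi ->
  square x -> ~ Tpp x -> phi x = 0.
Proof. by move=> [[p o2 o1 _ _] _ _ _]; exact: odd_periodic_boundary. Qed.

Lemma solution_laplacian_at K s eps phi x : is_solution K s eps phi -> Tpp x ->
  laplacian_at phi x (G s eps (phi x)).
Proof.
by move=> [_ _ C2 eqn] Tx; rewrite -eqn//; exact: C2_on_laplacian_at open_Tpp C2 Tx.
Qed.

(** For positive [t], [- G] is the maximum of 1 and (eps / t)^s. *)
Lemma G_le s eps (t : R) : 0 < s -> 0 < eps -> 0 < t ->
  G s eps t <= - 1 /\ G s eps t <= - (eps `^ s * t `^ (- s)).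
Proof.
move=> s0 e0 t0; have ts : 0 < t `^ s by exact: powR_gt0.
rewrite /G /Gpos t0 powRN; case: (ltP t eps) => et; split => //; rewrite lerN2.
- rewrite ler_pdivlMr// mul1r; apply: ge0_ler_powR; rewrite ?nnegrE; exact: ltW.
- rewrite ler_pdivrMr// mul1r; apply: ge0_ler_powR; rewrite ?nnegrE//; exact: ltW.
Qed.

(** The maximum of two positive numbers is strictly below their sum; this supplies the strict sign
    in the maximum principle. *)
Lemma G_ge s eps (t u : R) : 0 < s -> 0 < eps -> 0 < u -> u <= t ->
  - 1 - eps `^ s * u `^ (- s) < G s eps t.
Proof.
move=> s0 e0 u0 ut; have t0 := lt_le_trans u0 ut.
have h : 0 < eps `^ s * u `^ (- s) by rewrite mulr_gt0// powR_gt0.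
rewrite /G /Gpos t0; case: (ltP t eps) => et; last by lra.
suff : eps `^ s / t `^ s <= eps `^ s * u `^ (- s) by lra.
rewrite powRN ler_wpM2l ?powR_ge0// lef_pV2 ?posrE ?powR_gt0//.
by apply: ge0_ler_powR; rewrite ?nnegrE// ltW.
Qed.

Lemma barrier_ge0 s eps Psi x : is_barrier s eps Psi -> Rpp_closed x -> 0 <= Psi x.
Proof.
move=> hP xp; have [/(barrier_gt0 hP)/ltW//|nx] := pselect (Rpp x).
by rewrite (barrier_boundary hP).
Qed.

Lemma solution_le K s eps phi Psi (b : R) : 0 < s -> 0 < eps -> 0 < b < 2 ->
  is_solution K s eps phi -> is_barrier s eps Psi ->
  forall x, Tpp x -> phi x <= Psi x + 16 / (4 - b ^+ 2) * mono 1 b x.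
Proof.
move=> s0 e0 /andP[b0 b2] hphi hP.
have b4 : 0 < 4 - b ^+ 2 by nra.
(* The Laplacian of [mono 2 b] has the coefficient [b ^+ 2 - 16] on [mono 2 (b - 2)]; the value
   [B * (4 - b ^+ 2) = 16] compensates it. *)
set B := 16 / (4 - b ^+ 2).
have BE : B * (4 - b ^+ 2) = 16 by rewrite /B divfK// gt_eqF.
have B1 : 1 <= B by rewrite ler_pdivlMr// mul1r; nra.
pose W x := 2^-1 * (B * mono 1 b x - mono 2 b x).
have W0 x : Rpp_closed x -> 0 <= W x.
  move=> [x1 x2]; rewrite mulr_ge0// subr_ge0.
  have [xp|xn] := pselect (Rpp x).
    have := @mono_le R 2 1 b x xp; have := mono_gt0 1 b xp; nra.
  have x12 : x.1 * x.2 = 0.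
    apply/eqP; rewrite mulf_eq0; apply/negPn/negP; rewrite negb_or => /andP[z1 z2].
    by apply: xn; split; rewrite lt_neqAle eq_sym ?z1 ?z2.
  by rewrite /mono x12 !powR0 ?mul0r ?mulr0.
have WB x : W x <= B * mono 1 b x.
  have := mono_ge0 1 b x; have := mono_ge0 2 b x; rewrite /W; nra.
have Wl x : Tpp x -> exists2 l, l <= - 1 & laplacian_at W x l.
  move=> Tx; have xp := Tpp_Rpp Tx; eexists; last first.
    apply: laplacian_atZ; apply: laplacian_atB; last exact: laplacian_at_mono.
    by apply: laplacian_atZ; exact: laplacian_at_mono.
  have m1 := mono_gt0 1 (b - 2) xp; have m2 := mono_gt0 2 (b - 2) xp.
  have m12 : mono 2 (b - 2) x <= mono 1 (b - 2) x by apply: mono_le => //; lra.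
  (* This is a nonpositive power of [nsq x], which is at most 1 on [Tpp]; it provides the whole of
     [- Delta W >= 1]. *)
  have m0 : 1 <= mono (2 - 2) (b - 2) x.
    rewrite subrr mono0 -[leLHS](powRr0 (nsq x)); apply: ger_powR; last by lra.
    rewrite nsq_gt0//=; case: Tx => /andP[x1 x1'] /andP[x2 x2']; rewrite /nsq; nra.
  have : B * (4 - b ^+ 2) * mono 1 (b - 2) x = 16 * mono 1 (b - 2) x by rewrite BE.
  have : 0 <= b ^+ 2 * mono 2 (b - 2) x by rewrite mulr_ge0 ?sqr_ge0// ltW.
  lra.
move=> x Tx.
suff : phi x - (Psi x + W x) <= 0 by have := WB x; lra.
have cl (y : R * R) : square y -> Rpp_closed y.
  by move=> [/=]; rewrite !in_itv/= => /andP[y1 _] /andP[y2 _].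
apply: (@square_comparison _ phi (fun y => phi y - (Psi y + W y))) Tx => //.
- exact: solution_continuous hphi.
- move=> y /Tpp_square/cl yc; have := W0 _ yc; have := barrier_ge0 hP yc; lra.
- move=> y sy nT; rewrite (solution_boundary hphi)//; split => //.
  by have yc := cl _ sy; have := W0 _ yc; have := barrier_ge0 hP yc; lra.
- move=> y Ty; have yp := Tpp_Rpp Ty; apply: (@cvgB _ _ _ (nbhs y)).
    exact: solution_continuous hphi _.
  apply: (@cvgD _ _ _ (nbhs y)); first exact: barrier_continuous_at hP yp.
  apply: (@cvgM _ _ (nbhs y)); first exact: cvg_cst.
  apply: (@cvgB _ _ _ (nbhs y)); last exact: mono_continuous.
  by apply: (@cvgM _ _ (nbhs y)); [exact: cvg_cst|exact: mono_continuous].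
- move=> y Ty; have yp := Tpp_Rpp Ty; rewrite subr_gt0 => vy.
  have [l l1 Wy] := Wl _ Ty.
  eexists; last first.
    apply: laplacian_atB; first exact: solution_laplacian_at hphi Ty.
    by apply: laplacian_atD Wy; exact: barrier_laplacian_at hP yp.
  have P0 := barrier_gt0 hP yp; have W0y := W0 _ (cl _ (Tpp_square Ty)).
  (* Where [phi > Psi + W] also [phi >= Psi], hence [Delta phi > - 1 - eps^s Psi^(-s) >= Delta (Psi
     + W)]. *)
  have := @G_ge s eps (phi y) (Psi y) s0 e0 P0.
  move=> /(_ _); lra.
Qed.

(* [eta] removes the singularity at the origin; it is taken equal to [rho ^+ 2] when the
   bound is used on the circle of radius [rho]. *)
Lemma solution_ge K s eps phi (eta : R) : 0 < s -> 0 < eps -> 0 < eta ->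
  is_solution K s eps phi -> (forall x, Tpp x -> 0 < phi x) ->
  forall x, Tpp x ->
  - (16^-1 * (x.1 * x.2 * ln (nsq x + eta) + ln 4 * (x.1 * x.2))) <= phi x.
Proof.
move=> s0 e0 eta0 hphi phi0 x Tx.
(* The summand with [ln 4] makes [V] at most 0 on the outer sides, where [nsq x >= 1/4]. *)
pose V (x : R * R) := - 16^-1 * (x.1 * x.2 * ln (nsq x + eta) + ln 4 * (x.1 * x.2)).
suff : V x - phi x <= 0 by rewrite /V; lra.
have N0 y : 0 < nsq y + eta by rewrite ltr_wpDl// nsq_ge0.
have cV y : {for y, continuous V}.
  apply: (@cvgM _ _ (nbhs y)); first exact: cvg_cst.
  apply: (@cvgD _ _ _ (nbhs y)); last first.
    by apply: (@cvgM _ _ (nbhs y)); [exact: cvg_cst|exact: xy_continuous].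
  apply: (@cvgM _ _ (nbhs y)); first exact: xy_continuous.
  apply: (continuous_comp (f := fun y => nsq y + eta) (g := @ln R)).
    by apply: (@cvgD _ _ _ (nbhs y)); [exact: nsq_continuous|exact: cvg_cst].
  exact: continuous_ln.
have cv y : {for y, continuous (fun y => V y - phi y)}.
  apply: (@cvgB _ _ _ (nbhs y)); [exact: cV|exact: solution_continuous hphi _].
apply: (@square_comparison _ (fun y => V y - phi y) (fun y => V y - phi y)) Tx => //.
- move=> y sy nT; split => //; rewrite (solution_boundary hphi)// subr0.
  rewrite /V mulNr oppr_le0 mulr_ge0//.
  have y12 : 0 <= y.1 * y.2.
    by case: sy => /=; rewrite !in_itv/= => /andP[? _] /andP[? _]; rewrite mulr_ge0.
  have [y1|y1|y1|y1] := square_boundary sy nT; rewrite ?y1 ?mul0r ?mulr0 ?mul0r ?addr0//.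
    rewrite -y1 (mulrC (ln 4)) -mulrDr mulr_ge0// -lnM ?posrE// ln_ge0//.
    rewrite /nsq y1; have := sqr_ge0 y.2; lra.
  rewrite -y1 (mulrC (ln 4)) -mulrDr mulr_ge0// -lnM ?posrE// ln_ge0//.
  rewrite /nsq y1; have := sqr_ge0 y.1; lra.
- move=> y Ty vy; have yp := Tpp_Rpp Ty.
  eexists; last first.
    apply: laplacian_atB; last exact: solution_laplacian_at hphi Ty.
    apply: laplacian_atZ; apply: laplacian_atD; first exact: laplacian_at_xy_ln.
    apply: laplacian_atZ; exists 0, 0; split; last reflexivity.
      have := jet2_derive2_at (jet2_affine y.2 0 y.1); apply: derive2_at_eq => t.
      by rewrite addr0 mulrC.
    have := jet2_derive2_at (jet2_affine y.1 0 y.2); apply: derive2_at_eq => t.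
    by rewrite addr0.
  have [G1 _] := G_le s0 e0 (phi0 _ Ty).
  have X := xy_le_nsq y; have Ny := N0 y; have nn := nsq_ge0 y.
  have y120 : 0 < y.1 * y.2 by case: yp => ? ?; rewrite mulr_gt0.
  (* The two fractions are at most 4 and 2, so the Laplacian of [V] is at least -6/16, above the
     bound -1 for that of [phi]. *)
  have h1 : 8 * (y.1 * y.2) / (nsq y + eta) <= 4 by rewrite ler_pdivrMr//; lra.
  have h2 : 4 * eta * (y.1 * y.2) / (nsq y + eta) ^+ 2 <= 2.
    rewrite ler_pdivrMr ?exprn_gt0//; nra.
  lra.
Qed.

(** Since [G(phi) <= - eps^s phi^(-s)], the difference [Psi - phi] has a positive Laplacian wherever
    it is positive; on the axes [Psi] is 0. *)
Lemma barrier_le_solution K s eps phi Psi (rho : R) : 0 < s -> 0 < eps ->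
  0 < rho < 2^-1 ->
  is_solution K s eps phi -> (forall x, Tpp x -> 0 < phi x) ->
  is_barrier s eps Psi ->
  (forall x, Rpp x -> nsq x = rho ^+ 2 -> Psi x <= phi x) ->
  forall x, Rpp x -> nsq x <= rho ^+ 2 -> Psi x <= phi x.
Proof.
move=> s0 e0 /andP[r0 r2] hphi phi0 hP Pphi x xp xr; rewrite -subr_le0.
pose D := (`[0, rho] `*` `[0, rho]) `&` (@nsq R @^-1` [set t | t <= rho ^+ 2]).
have DE y : Rpp_closed y -> nsq y <= rho ^+ 2 -> D y.
  move=> [y1 y2] yr; split => //; split; rewrite /= in_itv/= ?y1 ?y2/=.
    by move: yr; rewrite /nsq => yr; rewrite -(@ler_pXn2r _ 2) ?nnegrE//; [nra|exact: ltW].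
  by move: yr; rewrite /nsq => yr; rewrite -(@ler_pXn2r _ 2) ?nnegrE//; [nra|exact: ltW].
have cl y : D y -> Rpp_closed y.
  by move=> [[/=]]; rewrite !in_itv/= => /andP[y1 _] /andP[y2 _] _.
have DT y : D y -> Rpp y -> Tpp y.
  move=> [[/=]]; rewrite !in_itv/= => /andP[y1 y1'] /andP[y2 y2'] _ [y1p y2p].
  by split; rewrite ?y1p ?y2p/=; lra.
have Ds y : D y -> square y.
  move=> [[/=]]; rewrite !in_itv/= => /andP[y1 y1'] /andP[y2 y2'] _.
  by split; rewrite /= in_itv/= ?y1 ?y2/=; lra.
have phige y : D y -> 0 <= phi y.
  move=> Dy; have [/phi0/ltW//|nT] := pselect (Tpp y).
  by rewrite (solution_boundary hphi)//; exact: Ds.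
have Pp y : D y -> 0 < Psi y -> Rpp y.
  move=> Dy Py; have [//|ny] := pselect (Rpp y).
  by move: Py; rewrite (barrier_boundary hP) ?ltxx//; split => //; exact: cl.
apply: (@maximum_principle _ D Psi (fun y => Psi y - phi y)); last first.
- by apply: DE => //; case: xp => ? ?; split; exact: ltW.
- move=> y Dy; rewrite subr_gt0 => vy.
  have yp : Rpp y by apply: Pp => //; exact: le_lt_trans (phige _ Dy) vy.
  have Ty := DT _ Dy yp; have fy := phi0 _ Ty.
  split.
    (* The arc is excluded by the hypothesis on it, so the nearby points of the quadrant stay in
       [D]. *)
    have yr : nsq y < rho ^+ 2.
      rewrite lt_neqAle; apply/andP; split; last by case: Dy.
      by apply/eqP => /(Pphi _ yp); rewrite leNgt vy.
    have n1 : \forall z \near y, Rpp z by apply: open_nbhs_nbhs; split => //;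
      exact: open_Rpp.
    have n2 : \forall z \near y, nsq z < rho ^+ 2.
      by have := @nsq_continuous R y; move=> /cvgr_lt; apply.
    near=> z; apply: DE; last by apply/ltW; near: z.
    have [z1 z2] : Rpp z by near: z.
    by split; exact: ltW.
  eexists; last first.
    by apply: laplacian_atB; [exact: barrier_laplacian_at hP yp|exact:
      solution_laplacian_at hphi Ty].
  have [_ G1] := G_le s0 e0 fy.
  have : eps `^ s * Psi y `^ (- s) < eps `^ s * phi y `^ (- s).
    rewrite ltr_pM2l ?powR_gt0// !powRN ltf_pV2 ?posrE ?powR_gt0//;
      last exact: lt_trans fy vy.
    by apply: gt0_ltr_powR => //; rewrite nnegrE ltW//; exact: lt_trans fy vy.
  lra.
- move=> y Dy Py; have yp := Pp _ Dy Py; apply: (@cvgB _ _ _ (nbhs y)).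
    exact: barrier_continuous_at hP yp.
  exact: solution_continuous hphi _.
- by move=> y Dy; have := phige _ Dy; lra.
- by apply: continuous_subspaceW (barrier_continuous hP) => y; exact: cl.
- apply: compact_box; apply: closed_comp; last exact: closed_le.
  by move=> y _; exact: nsq_continuous.
Unshelve. all: by end_near. Qed.

End Solution.

(** * Integration on the torus *)

Section AreaPreserving.
Context {R : realType}.
Local Notation mR := (measurableTypeR R).
Local Notation leb := (@lebesgue_measure R).
Local Notation area := ((@lebesgue_measure R) \x (@lebesgue_measure R))%E.

Definition leb_preserving (t : mR -> mR) : Prop := measurable_fun setT t /\
  forall A, measurable A -> leb (t @^-1` A) = leb A.

Lemma leb_preserving_id : leb_preserving id.
Proof. by split => //; exact: measurable_id. Qed.

(** Lebesgue measure is determined by its values on half-open intervals, whose lengths are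
    preserved. *)
Lemma leb_preserving_shift (a : R) : leb_preserving (fun y => y - a).
Proof.
have mt : measurable_fun setT (fun y : mR => (y - a) : mR).
  suff H : measurable_fun (setT : set R) (fun y : R => y - a) by exact: H.
  by apply: measurable_funB => //; exact: measurable_id.
split => // A mA; apply/esym.
suff : leb A = pushforward leb (fun y : mR => (y - a) : mR) A by [].
apply: lebesgue_measure_unique mA => // _ [[u w]] _ <-;
rewrite -[RHS]/(leb ((fun y : mR => (y - a) : mR) @^-1` `]u, w]%classic)).
rewrite (_ : _ @^-1` _ = `]u + a, w + a]%classic); last first.
  by apply/seteqP; split => y /=; rewrite !in_itv/=; lra.
by rewrite !lebesgue_measure_itv/= !lte_fin ltrD2r -!EFinB; case: ifP => // _;
  congr EFin; ring.
Qed.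

Lemma leb_preserving_reflect (a : R) : leb_preserving (fun y => a - y).
Proof.
have mt : measurable_fun setT (fun y : mR => (a - y) : mR).
  suff H : measurable_fun (setT : set R) (fun y : R => a - y) by exact: H.
  by apply: measurable_funB => //; exact: measurable_id.
split => // A mA; apply/esym.
suff : leb A = pushforward leb (fun y : mR => (a - y) : mR) A by [].
apply: lebesgue_measure_unique mA => // _ [[u w]] _ <-;
rewrite -[RHS]/(leb ((fun y : mR => (a - y) : mR) @^-1` `]u, w]%classic)).
rewrite (_ : _ @^-1` _ = `[a - w, a - u[%classic); last first.
  by apply/seteqP; split => y /=; rewrite !in_itv/=; lra.
by rewrite !lebesgue_measure_itv/= !lte_fin ltrD2l ltrN2 -!EFinB; case: ifP => // _;
  congr EFin; ring.
Qed.

Section Transfer.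
Variables (t1 t2 : mR -> mR).
Hypotheses (h1 : leb_preserving t1) (h2 : leb_preserving t2).
Let t (y : mR * mR) : mR * mR := (t1 y.1, t2 y.2).

Let mt : measurable_fun setT t.
Proof.
apply/measurable_fun_pairP; split.
- by apply: (measurableT_comp (f := t1)); [exact: h1.1|exact: measurable_fst].
- by apply: (measurableT_comp (f := t2)); [exact: h2.1|exact: measurable_snd].
Qed.

Let area_pushforward (A : set (mR * mR)) : measurable A ->
  area A = pushforward area t A.
Proof.
move=> mA; apply: product_measure_unique mA => // B C mB mC.
rewrite -[LHS]/(area ((t1 @^-1` B) `*` (t2 @^-1` C))).
have [m1 p1] := h1; have [m2 p2] := h2.
rewrite product_measure1E; first by congr (_ * _)%E; [exact: p1|exact: p2].
- by rewrite -(setTI (_ @^-1` _)); exact: m1.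
- by rewrite -(setTI (_ @^-1` _)); exact: m2.
Qed.

Lemma ge0_area_transfer (D : set (mR * mR)) (f : mR * mR -> \bar R) :
  measurable D -> measurable_fun D f -> (forall y, 0 <= f y)%E ->
  (\int[area]_(y in D) f y = \int[area]_(y in t @^-1` D) f (t y))%E.
Proof.
move=> mD mf f0.
have H := @ge0_integral_pushforward _ _ _ _ R t mt area D f mD mf.
apply: etrans (H _); last by move=> y _; exact: f0.
by apply: eq_measure_integral => A mA _; exact: area_pushforward.
Qed.

Lemma integrable_transfer (D : set (mR * mR)) (f : mR * mR -> \bar R) :
  measurable D -> area.-integrable D f -> area.-integrable (t @^-1` D) (f \o t).
Proof.
move=> mD /integrableP[mf fi]; apply/integrableP; split.
  apply: (measurable_comp mD) => //; first by move=> _ [y Dy <-].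
  exact: measurable_funS mt.
rewrite -(ge0_area_transfer (f := fun y => `|f y|%E))//.
exact: measurableT_comp.
Qed.

End Transfer.

Lemma integrable_union (A B : set (mR * mR)) (f : mR * mR -> \bar R) :
  measurable A -> measurable B -> area.-integrable A f -> area.-integrable B f ->
  area.-integrable (A `|` B) f.
Proof.
move=> mA mB /integrableP[mfA fA] /integrableP[mfB fB].
have mf : measurable_fun (A `|` B) f by apply/measurable_funU.
apply/integrableP; split => //.
have mAB : measurable (B `\` A) by exact: measurableD.
have E : A `|` B = A `|` (B `\` A) by rewrite setDE setUIr setUv setIT.
rewrite E ge0_integral_setU//.
- apply: lte_add_pinfty => //; apply: le_lt_trans fB.
  by apply: ge0_subset_integral => //; exact: measurableT_comp.
- by apply: measurableT_comp => //; rewrite -E.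
- by apply/disj_setPS => y [Ay [_ /(_ Ay)]].
Qed.

Lemma measurable_torus_cell : measurable (@torus_cell R).
Proof. by apply: measurableX; exact: measurable_itv. Qed.

(** Periodicity extends integrability from one cell to a block of 2 by 2 cells, which contains the
    cell centred at [x]; the reflection [y] to [x - y] maps [torus_cell] onto that cell. *)
Lemma green_shift_integrable (K : R * R -> R) (x : R * R) : is_torus_green K ->
  Tpp x -> area.-integrable (@torus_cell R) (EFin \o (fun y : mR * mR => K (x - y))).
Proof.
move=> [Kp Ki _ _] [/andP[x1 x1'] /andP[x2 x2']].
pose f : mR * mR -> \bar R := EFin \o (K : mR * mR -> R).
pose I := [set` `[(- 2^-1 : R), 2^-1]] : set mR.
pose J := [set` `[(2^-1 : R), 2^-1 + 1]] : set mR.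
have mI : measurable I by exact: measurable_itv.
have mJ : measurable J by exact: measurable_itv.
have step1 (A : set mR) : measurable A -> area.-integrable (I `*` A) f ->
    area.-integrable (J `*` A) f.
  move=> mA Af.
  have := integrable_transfer (leb_preserving_shift 1) leb_preserving_id (measurableX mI
    mA) Af.
  set D := _ @^-1` _; have -> : D = J `*` A.
    apply/seteqP; split => -[u w]; rewrite /D /I /J /=; rewrite !in_itv/= => -[? ?];
      split => //; lra.
  congr integrable; apply/funext => -[u w]; rewrite /f/=; congr EFin.
  have [+ _] := Kp (u - 1, w); rewrite /e1 /GRing.add/= /add_pair/= => <-.
  by congr (K (_, _)); rewrite ?addr0 ?subrK.
have step2 (A : set mR) : measurable A -> area.-integrable (A `*` I) f ->
    area.-integrable (A `*` J) f.
  move=> mA Af.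
  have := integrable_transfer leb_preserving_id (leb_preserving_shift 1) (measurableX mA
    mI) Af.
  set D := _ @^-1` _; have -> : D = A `*` J.
    apply/seteqP; split => -[u w]; rewrite /D /I /J /=; rewrite !in_itv/= => -[? ?];
      split => //; lra.
  congr integrable; apply/funext => -[u w]; rewrite /f/=; congr EFin.
  have [_] := Kp (u, w - 1); rewrite /e1 /GRing.add/= /add_pair/= => <-.
  by congr (K (_, _)); rewrite ?addr0 ?subrK.
have XUl (A : set mR) : (I `|` J) `*` A = (I `*` A) `|` (J `*` A).
  by apply/seteqP; split => -[u w]; rewrite /setX/=; tauto.
have XUr (A : set mR) : A `*` (I `|` J) = (A `*` I) `|` (A `*` J).
  by apply/seteqP; split => -[u w]; rewrite /setX/=; tauto.
have II : area.-integrable (I `*` I) f by [].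
have IJ := step2 _ mI II; have JI := step1 _ mI II; have JJ := step1 _ mJ IJ.
have UI : area.-integrable ((I `|` J) `*` I) f.
  by rewrite XUl; apply: integrable_union => //; exact: measurableX.
have UJ : area.-integrable ((I `|` J) `*` J) f.
  by rewrite XUl; apply: integrable_union => //; exact: measurableX.
have mIJ : measurable (I `|` J) by exact: measurableU.
have UU : area.-integrable ((I `|` J) `*` (I `|` J)) f.
  by rewrite XUr; apply: integrable_union => //; exact: measurableX.
pose B1 := [set` `[x.1 - 2^-1, x.1 + 2^-1]] : set mR.
pose B2 := [set` `[x.2 - 2^-1, x.2 + 2^-1]] : set mR.
have mB1 : measurable B1 by exact: measurable_itv.
have mB2 : measurable B2 by exact: measurable_itv.
have Bf : area.-integrable (B1 `*` B2) f.
  apply: integrableS UU; [exact: measurableX|exact: measurableX|].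
  move=> [u w]; rewrite /B1 /B2 /I /J/= !in_itv/= => -[/andP[u1 u2] /andP[w1 w2]].
  split.
    by have [u12|u12] := leP u 2^-1; [left|right]; apply/andP; split; lra.
  by have [u12|u12] := leP w 2^-1; [left|right]; apply/andP; split; lra.
have := integrable_transfer (leb_preserving_reflect x.1) (leb_preserving_reflect x.2)
  (measurableX mB1 mB2) Bf.
set D := _ @^-1` _; have -> // : D = @torus_cell R.
apply/seteqP; split => -[u w]; rewrite /D /B1 /B2 /torus_cell /=;
  rewrite !in_itv/= => -[? ?]; split => //; lra.
Qed.

(** Reflecting the first coordinate exchanges the positive and negative parts. *)
Lemma torus_int_odd (u : mR * mR -> R) : measurable_fun setT u ->
  (forall x1 x2 : R, u (x1, x2) = - u (- x1, x2)) -> torus_int u = 0.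
Proof.
move=> mu uo.
have mE : measurable_fun (@torus_cell R) (EFin \o u).
  by apply/measurable_EFinP; exact: measurable_funTS.
rewrite /torus_int /Rintegral integralE.
set a := (\int[_]_(_ in _) _)%E; set b := (\int[_]_(_ in _) _)%E.
(* Equal finite values cancel, and the real part of an infinite value is 0 by convention. *)
suff -> : a = b by case: b => [r| |]//=; rewrite subrr.
rewrite /a (ge0_area_transfer (leb_preserving_reflect 0) leb_preserving_id)//.
- rewrite /b; set D := _ @^-1` _; have -> : D = @torus_cell R.
    by apply/seteqP; split => -[v w]; rewrite /D /torus_cell /=;
      rewrite !in_itv/= => -[? ?]; split => //; lra.
  apply: eq_integral => -[v w] _; rewrite funeposE funenegE/= sub0r.
  by rewrite (uo v w) /= opprK.
- exact: measurable_torus_cell.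
- exact: measurable_funepos.
Qed.

End AreaPreserving.

(** * Positivity of the Bahouri-Chemin function *)

Section Trig.
Context {R : realType}.
Local Notation mR := (measurableTypeR R).
Implicit Types (x : R * R) (m : R * (R * R) * (R * R)) (s : seq (R * (R * R) * (R * R))).

Definition wave (w : R * R) (t : R) : R := sin (w.1 * t + w.2).

(* [(c, (a, p), (b, q))] stands for the function
   [c * sin (a * x.1 + p) * sin (b * x.2 + q)]; keeping the phases makes the family
   stable under differentiation. *)
Definition trig s x : R := \sum_(m <- s) m.1.1 * wave m.1.2 x.1 * wave m.2 x.2.

(** Uses cos t = sin(t + pi/2). *)
Definition trig_d1 s :=
  [seq (m.1.1 * m.1.2.1, (m.1.2.1, m.1.2.2 + pi / 2), m.2) | m <- s].

Definition trig_d2 s :=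
  [seq (m.1.1 * m.2.1, m.1.2, (m.2.1, m.2.2 + pi / 2)) | m <- s].

Lemma is_derive_wave (w : R * R) (t : R) :
  is_derive t (1 : R) (wave w) (w.1 * wave (w.1, w.2 + pi / 2) t).
Proof.
have H : is_derive (t : R) (1 : R) (fun t => w.1 * t + w.2) w.1.
  have := is_deriveD (is_deriveZ w.1 (is_derive_id (t : R) (1
    : R))) (is_derive_cst w.2 (t : R) (1 : R)).
  by move=> /is_derive_eq; apply; rewrite /GRing.scale/= mulr1 addr0.
have := @is_derive1_comp R (@sin R) (fun t => w.1 * t + w.2) t _ _ (is_derive_sin _) H.
by move=> /is_derive_eq; apply; rewrite /wave/= addrA sinDpihalf mulrC.
Qed.

Lemma trig_cons m s x :
  trig (m :: s) x = m.1.1 * wave m.1.2 x.1 * wave m.2 x.2 + trig s x.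
Proof. by rewrite /trig big_cons. Qed.

Lemma trig_nil x : trig [::] x = 0.
Proof. by rewrite /trig big_nil. Qed.

Lemma is_derive_trig1 s x : is_derive x (e1 : R * R) (trig s) (trig (trig_d1 s) x).
Proof.
case: x => a b; apply/(is_derive_section1 (trig s)).
elim: s => [|m s IH].
  rewrite (_ : (fun _ => _) = cst 0); last by apply/funext => t; rewrite trig_nil.
  by rewrite trig_nil; exact: is_derive_cst.
rewrite (_ : (fun _ => _) = (m.1.1 * wave m.2 b) *: wave m.1.2 + (fun t => trig s (t,
  b))); last first.
  apply/funext => t; rewrite trig_cons/= mulrAC //.
apply: is_derive_eq (is_deriveD (is_deriveZ _ (is_derive_wave _ _)) IH) _.
by rewrite trig_cons/= /GRing.scale/=; ring.
Qed.

Lemma is_derive_trig2 s x : is_derive x (e2 : R * R) (trig s) (trig (trig_d2 s) x).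
Proof.
case: x => a b; apply/(is_derive_section2 (trig s)).
elim: s => [|m s IH].
  rewrite (_ : (fun _ => _) = cst 0); last by apply/funext => t; rewrite trig_nil.
  by rewrite trig_nil; exact: is_derive_cst.
rewrite (_ : (fun _ => _) = (m.1.1 * wave m.1.2 a) *: wave m.2 + (fun t => trig s (a,
  t))); last first.
  by apply/funext => t; rewrite trig_cons.
apply: is_derive_eq (is_deriveD (is_deriveZ _ (is_derive_wave _ _)) IH) _.
by rewrite trig_cons/= /GRing.scale/=; ring.
Qed.

Lemma D_trig1 s : 'D_e1 (trig s) = trig (trig_d1 s).
Proof. by apply/funext => x; have [_] := is_derive_trig1 s x. Qed.

Lemma D_trig2 s : 'D_e2 (trig s) = trig (trig_d2 s).
Proof. by apply/funext => x; have [_] := is_derive_trig2 s x. Qed.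

Lemma wave_continuous w : continuous (wave w).
Proof.
move=> t; apply/differentiable_continuous/derivable1_diffP.
by have [] := is_derive_wave w t.
Qed.

Lemma trig_continuous s : continuous (trig s).
Proof.
elim: s => [|m s IH] x.
  rewrite (_ : trig [::] = cst 0); first exact: cst_continuous.
  by apply/funext => t; rewrite trig_nil.
rewrite (_ : trig (m :: s) = fun x => m.1.1 * wave m.1.2 x.1 * wave m.2 x.2 + trig s x);
  last first.
  by apply/funext => y; rewrite trig_cons.
apply: (@cvgD _ _ _ (nbhs x)); last exact: IH.
apply: (@cvgM _ _ (nbhs x)); first apply: (@cvgM _ _ (nbhs x)); first exact: cvg_cst.
  by apply: (continuous_comp (g := wave m.1.2)); [exact: cvg_fst|exact: wave_continuous].
by apply: (continuous_comp (g := wave m.2)); [exact: cvg_snd|exact: wave_continuous].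
Qed.

Lemma C1_on_trig s U : C1_on U (trig s).
Proof.
move=> x _; rewrite (D_trig1 s) (D_trig2 s); split.
- by have [] := is_derive_trig1 s x.
- by have [] := is_derive_trig2 s x.
- exact: trig_continuous.
- exact: trig_continuous.
Qed.

Lemma C2_on_trig s U : C2_on U (trig s).
Proof. by split; rewrite ?(D_trig1 s) ?(D_trig2 s); exact: C1_on_trig. Qed.

Lemma measurable_wave (w : R * R) : measurable_fun setT (wave w : mR -> R).
Proof.
suff H : measurable_fun (setT : set R) (wave w : R -> R) by exact: H.
by apply: continuous_measurable_fun; exact: wave_continuous.
Qed.

Lemma measurable_trig s : measurable_fun setT (trig s : mR * mR -> R).
Proof.
elim: s => [|m s IH].
  rewrite (_ : trig [::] = cst 0); first exact: measurable_cst.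
  by apply/funext => t; rewrite trig_nil.
rewrite (_ : trig (m :: s) = fun x => m.1.1 * wave m.1.2 x.1 * wave m.2 x.2 + trig s x);
  last first.
  by apply/funext => y; rewrite trig_cons.
apply: measurable_funD => //; apply: measurable_funM; first apply: measurable_funM.
- exact: measurable_cst.
- by apply: (measurableT_comp (f := wave m.1.2 : mR -> R));
  [exact: measurable_wave|exact: measurable_fst].
- by apply: (measurableT_comp (f := wave m.2 : mR -> R));
  [exact: measurable_wave|exact: measurable_snd].
Qed.

End Trig.

(** * Odd trigonometric polynomials converging to the sign *)

Section Oscillation.
Context {R : realType}.
Implicit Types (f g h : R -> R) (c : R * int) (s : seq (R * int)).

Definition freq (k : int) : R := 2 * pi * k%:~R.

Definition osc s (t : R) : R := \sum_(c <- s) c.1 * sin (freq c.2 * t).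

Definition odd_trig f : Prop := exists s, f =1 osc s.

Lemma odd_trigD f g : odd_trig f -> odd_trig g -> odd_trig (fun t => f t + g t).
Proof. by move=> [s fs] [s' gs]; exists (s ++ s') => t; rewrite fs gs /osc big_cat. Qed.

Lemma odd_trigZ k f : odd_trig f -> odd_trig (fun t => k * f t).
Proof.
move=> [s fs]; exists [seq (k * c.1, c.2) | c <- s] => t.
by rewrite fs /osc big_map mulr_sumr; apply: eq_bigr => c _; rewrite mulrA.
Qed.

Lemma odd_trig_sum s (F : R * int -> R -> R) : (forall c, odd_trig (F c)) ->
  odd_trig (fun t => \sum_(c <- s) F c t).
Proof.
move=> HF; elim: s => [|c s [s' IH]]; first by exists [::] => t; rewrite /osc !big_nil.
have [s'' sF] := odd_trigD (HF c) (ex_intro _ s' IH).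
by exists s'' => t; rewrite big_cons; exact: sF.
Qed.

(** A product of three sines is again a sum of sines, whereas two would give cosines; hence odd
    trigonometric polynomials are stable under cubing. *)
Lemma sin_mul3 (a b c : R) : sin a * sin b * sin c =
  4^-1 * sin (a + b - c) + 4^-1 * sin (a - b + c) + 4^-1 * sin (- a + b + c) -
  4^-1 * sin (a + b + c).
Proof. by rewrite !(sinD, cosD, sinN, cosN); field. Qed.

Lemma odd_trig_sin3 (i j k : int) :
  odd_trig (fun t => sin (freq i * t) * sin (freq j * t) * sin (freq k * t)).
Proof.
exists [:: (4^-1, (i + j - k)%R); (4^-1, (i - j + k)%R); (4^-1, (- i + j + k)%R);
           (- 4^-1, (i + j + k)%R)] => t.
have freqD (m n : int) : freq (m + n)%R = freq m + freq n by rewrite /freq rmorphD mulrDr.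
have freqN (m : int) : freq (- m)%R = - freq m by rewrite /freq rmorphN mulrN.
rewrite sin_mul3 /osc !big_cons big_nil/= !freqD !freqN !mulrDl !mulNr; ring.
Qed.

Lemma odd_trig_cube f : odd_trig f -> odd_trig (fun t => f t ^+ 3).
Proof.
move=> [s fs].
have [s' ss'] : odd_trig (fun t => \sum_(a <- s) \sum_(b <- s) \sum_(c <- s)
    (a.1 * b.1 * c.1) * (sin (freq a.2 * t) * sin (freq b.2 * t) * sin (freq c.2 * t))).
  do 3 (apply: odd_trig_sum => ?); apply: odd_trigZ; exact: odd_trig_sin3.
exists s' => t; rewrite -ss' fs /osc exprS expr2.
rewrite mulr_suml; apply: eq_bigr => a _; rewrite mulr_suml mulr_sumr.
by apply: eq_bigr => b _; rewrite !mulr_sumr; apply: eq_bigr => c _; ring.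
Qed.

(* The iterates of this odd map converge to 1 on ]0, 1]. *)
Definition sharpen (y : R) : R := y * (3 - y ^+ 2) / 2.

Definition square_wave (n : nat) (t : R) : R := iter n sharpen (sin (2 * pi * t)).

Lemma odd_trig_square_wave n : odd_trig (square_wave n).
Proof.
elim: n => [|n IH].
  by exists [:: (1, 1%:Z)] => t; rewrite /osc big_cons big_nil /freq addr0 mul1r mulr1.
have [s ss] := odd_trigD (odd_trigZ (3 / 2) IH) (odd_trigZ (- 2^-1) (odd_trig_cube IH)).
by exists s => t; rewrite -ss/= /square_wave /= /sharpen; field.
Qed.

Lemma sharpenN y : sharpen (- y) = - sharpen y.
Proof. by rewrite /sharpen sqrrN; ring. Qed.

Lemma iter_sharpenN n y : iter n sharpen (- y) = - iter n sharpen y.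
Proof. by elim: n => //= n ->; rewrite sharpenN. Qed.

Lemma sharpen_itv y : 0 <= y <= 1 -> y <= sharpen y <= 1.
Proof.
move=> /andP[y0 y1]; rewrite /sharpen; apply/andP; split; first nra.
(* This product is [2 * (1 - sharpen y)]. *)
have : 0 <= (1 - y) ^+ 2 * (2 + y) by rewrite mulr_ge0 ?sqr_ge0//; lra.
nra.
Qed.

Lemma iter_sharpen_itv n y : 0 <= y <= 1 -> y <= iter n sharpen y <= 1.
Proof.
move=> y01; elim: n => [|n /andP[IH1 IH2]] /=; first by rewrite lexx; case/andP: y01.
have /sharpen_itv/andP[h1 h2] : 0 <= iter n sharpen y <= 1.
  by rewrite IH2 andbT; case/andP: y01 => y0 _; exact: le_trans IH1.
by rewrite h2 andbT; exact: le_trans h1.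
Qed.

Lemma iter_sharpen_le1 n y : `|y| <= 1 -> `|iter n sharpen y| <= 1.
Proof.
have pos (z : R) : 0 <= z <= 1 -> `|iter n sharpen z| <= 1.
  move=> z01; have /andP[h1 h2] := iter_sharpen_itv n z01.
  by rewrite ger0_norm//; apply: le_trans h1; case/andP: z01.
rewrite ler_norml => /andP[y0 y1]; have [yp|yn] := leP 0 y.
  by apply: pos; rewrite yp.
by rewrite -[y]opprK iter_sharpenN normrN; apply: pos; lra.
Qed.

Lemma iter_sharpen_cvg y : 0 < y <= 1 -> iter n sharpen y @[n --> \oo] --> (1 : R).
Proof.
move=> /andP[y0 y1].
have H n : 1 - iter n sharpen y <= (1 - y / 2) ^+ n.
  elim: n => [|n IH]; first by rewrite expr0 /=; lra.
  have /(iter_sharpen_itv n)/andP[h1 h2] : 0 <= y <= 1 by rewrite ltW.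
  rewrite exprS /= -/(iter n sharpen y); set z := iter n sharpen y in h1 h2 IH *.
  (* As [z >= y], the first factor is at most [1 - y / 2]: the distance to 1 decays
     geometrically. *)
  have -> : 1 - sharpen z = (1 - (z + z ^+ 2) / 2) * (1 - z) by rewrite /sharpen; field.
  by apply: ler_pM => //; nra.
have C : (1 - y / 2) ^+ n @[n --> \oo] --> (0 : R).
  by apply: cvg_expr; rewrite ger0_norm; lra.
apply: (@squeeze_cvgr _ _ _ _ (fun n => 1 - (1 - y / 2) ^+ n) (cst 1)); last exact: cvg_cst.
  near=> n; have /(iter_sharpen_itv n)/andP[h1 h2] : 0 <= y <= 1 by rewrite ltW.
  by rewrite h2 andbT; have := H n; lra.
by rewrite -[X in _ --> X]subr0; apply: cvgB; [exact: cvg_cst|exact: C].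
Unshelve. all: by end_near. Qed.

End Oscillation.

(** * Explicit solutions of the Poisson equation *)

Section Potential.
Context {R : realType}.
Implicit Types (x : R * R) (s : seq (R * int)) (t : R).

Lemma sin_freq_periodic (k : int) t : sin (freq k * (t + 1)) = sin (freq k * t).
Proof.
have H (n : nat) (u : R) : sin (u + 2 * pi * n%:R) = sin u.
  by rewrite -[RHS](periodicn (@sinD2pi R) n u); congr (sin (_ + _));
    rewrite -(mulr_natr (pi *+ 2)) -(mulr_natl pi 2).
case: k => n; rewrite mulrDr mulr1.
  exact: H.
(* [Negz n] is -(n + 1), so [n.+1] periods are added back. *)
by rewrite -[LHS](H n.+1); congr sin; rewrite /freq NegzE mulrNz; ring.
Qed.

Lemma laplacian_trigE (s : seq (R * (R * R) * (R * R))) :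
  laplacian (trig s) =
  (fun x => trig (trig_d1 (trig_d1 s)) x + trig (trig_d2 (trig_d2 s)) x).
Proof.
apply/funext => x; rewrite /laplacian D_trig1 D_trig2.
by have [_ ->] := is_derive_trig1 (trig_d1 s) x;
  have [_ ->] := is_derive_trig2 (trig_d2 s) x.
Qed.

Lemma laplacian_trig (s : seq (R * (R * R) * (R * R))) x :
  laplacian (trig s) x =
  \sum_(m <- s) - (m.1.2.1 ^+ 2 + m.2.1 ^+ 2) * (m.1.1 * wave m.1.2 x.1 * wave m.2 x.2).
Proof.
have wpi (w : R * R) t : wave (w.1, w.2 + pi / 2 + pi / 2) t = - wave w t.
  by rewrite /wave/= -addrA -splitr addrA sinDpi.
rewrite laplacian_trigE /trig /trig_d1 /trig_d2 !big_map -big_split/=.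
by apply: eq_bigr => m _; rewrite !wpi; ring.
Qed.

Lemma measurable_laplacian_trig (s : seq (R * (R * R) * (R * R))) :
  measurable_fun setT (laplacian (trig s) : measurableTypeR R * measurableTypeR R -> R).
Proof.
rewrite laplacian_trigE.
by apply: measurable_funD; exact: measurable_trig.
Qed.

(** Inverts [- Delta] mode by mode, dividing by its eigenvalue. *)
Definition potential_coefs s : seq (R * (R * R) * (R * R)) :=
  [seq (c.1 * d.1 / (freq c.2 ^+ 2 + freq d.2 ^+ 2), (freq c.2, 0), (freq d.2, 0)) |
     c <- s, d <- s].

Definition potential s := trig (potential_coefs s).

Lemma potentialE s x : potential s x = \sum_(c <- s) \sum_(d <- s)
  c.1 * d.1 / (freq c.2 ^+ 2 + freq d.2 ^+ 2) *
  sin (freq c.2 * x.1) * sin (freq d.2 * x.2).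
Proof.
rewrite /potential /trig big_allpairs_dep; apply: eq_bigr => c _.
by apply: eq_bigr => d _; rewrite /wave/= !addr0.
Qed.

Lemma laplacian_potential s x :
  laplacian (potential s) x = - (osc s x.1 * osc s x.2).
Proof.
rewrite laplacian_trig big_allpairs_dep /osc mulr_suml -sumrN; apply: eq_bigr => c _.
rewrite mulr_sumr -sumrN; apply: eq_bigr => d _; rewrite /wave/= !addr0.
(* If the eigenvalue is 0, both frequencies vanish and the sines make both sides 0. *)
have [F0|F0] := eqVneq (freq c.2 ^+ 2 + freq d.2 ^+ 2 : R) 0; last by field.
have /eqP -> : freq c.2 == 0 :> R.
  by have := F0; move/eqP; rewrite paddr_eq0 ?sqr_ge0// => /andP[]; rewrite sqrf_eq0.
by rewrite mul0r sin0; ring.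
Qed.

Lemma potential_biperiodic s : biperiodic (potential s).
Proof.
case=> a b; rewrite !potentialE; split.
  apply: eq_bigr => c _; apply: eq_bigr => d _.
  by rewrite /e1 /GRing.add/= /add_pair/= addr0 sin_freq_periodic.
apply: eq_bigr => c _; apply: eq_bigr => d _.
by rewrite /e2 /GRing.add/= /add_pair/= addr0 sin_freq_periodic.
Qed.

Lemma potential_odd1 s (a b : R) : potential s (a, b) = - potential s (- a, b).
Proof.
rewrite !potentialE -sumrN; apply: eq_bigr => c _; rewrite -sumrN; apply: eq_bigr => d _.
by rewrite /= mulrN sinN; ring.
Qed.

Lemma potential_odd2 s (a b : R) : potential s (a, b) = - potential s (a, - b).
Proof.
rewrite !potentialE -sumrN; apply: eq_bigr => c _; rewrite -sumrN; apply: eq_bigr => d _.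
by rewrite /= (mulrN (freq d.2)) sinN; ring.
Qed.

(** This is [green_repr] for the potential, whose mean vanishes by oddness. *)
Lemma torus_conv_potential (K : R * R -> R) s x : is_torus_green K ->
  torus_conv K (fun y => - (osc s y.1 * osc s y.2)) x = potential s x.
Proof.
move=> [_ _ _ Kr].
rewrite (_ : (fun _ => _) = laplacian (potential s)); last first.
  by apply/funext => y; rewrite laplacian_potential.
rewrite Kr ?torus_int_odd ?subr0//.
- exact: measurable_trig.
- exact: potential_odd1.
- exact: potential_biperiodic.
- exact: C2_on_trig.
Qed.

Lemma sin2pi_gt0 t : 0 < t < 2^-1 -> 0 < sin (2 * pi * t).
Proof.
move=> /andP[t0 t1]; have p0 := pi_gt0 R.
by apply: sin_gt0_pi; rewrite !mulr_gt0//=; nra.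
Qed.

Lemma square_wave_cvg t : - 2^-1 < t < 2^-1 -> t != 0 ->
  square_wave n t @[n --> \oo] --> sgn t.
Proof.
move=> /andP[t0 t1] tn; rewrite /sgn /square_wave; case: (ltP t 0) => tp.
  have S0 : 0 < sin (2 * pi * (- t)) by apply: sin2pi_gt0; lra.
  have := @iter_sharpen_cvg R (sin (2 * pi * (- t))).
  rewrite S0 sin_le1 => /(_ isT) /cvgN.
  apply: cvg_trans; apply: near_eq_cvg; apply: nearW => n /=.
  by rewrite (_ : 2 * pi * t = - (2 * pi * - t)) ?sinN ?iter_sharpenN//; ring.
apply: iter_sharpen_cvg; rewrite sin_le1 andbT; apply: sin2pi_gt0.
by rewrite lt_neqAle eq_sym tn tp.
Qed.

End Potential.

(** * Passage to the limit *)

Section BahouriChemin.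
Context {R : realType}.
Local Notation mR := (measurableTypeR R).
Local Notation leb := (@lebesgue_measure R).
Local Notation area := ((@lebesgue_measure R) \x (@lebesgue_measure R))%E.
Implicit Types (x : R * R) (K : R * R -> R).

Lemma measurable_sgn : measurable_fun setT (sgn : mR -> R).
Proof.
suff H : measurable_fun (setT : set R) (fun t : R => if t < 0 then - 1 else 1
  : R) by exact: H.
apply: measurable_fun_ifT => //.
by apply: measurable_fun_ltr => //; exact: measurable_id.
Qed.

Lemma torus_conv_square_wave K x : is_torus_green K -> Tpp x ->
  torus_conv K (fun y => - (square_wave n y.1 * square_wave n y.2)) x @[n --> \oo]
    --> bahouri_chemin K x.
Proof.
move=> hK Tx.
pose Kx (y : mR * mR) : R := K (x - y).
have iK : area.-integrable (@torus_cell R) (EFin \o Kx) by exact: green_shift_integrable.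
have mcell := @measurable_torus_cell R.
have mK : measurable_fun (@torus_cell R) Kx.
  by apply/measurable_EFinP; case/integrableP: iK.
pose f_ n (y : mR * mR) : \bar R := (Kx y * - (square_wave n y.1 * square_wave n y.2))%:E.
pose f (y : mR * mR) : \bar R := (Kx y * - (sgn y.1 * sgn y.2))%:E.
have mf_ n : measurable_fun (@torus_cell R) (f_ n).
  have [s sE] := odd_trig_square_wave (R := R) n.
  apply/measurable_EFinP; apply: measurable_funM => //; apply: measurable_funTS.
  rewrite (_ : (fun _ => _) = laplacian (potential s));
    first exact: measurable_laplacian_trig.
  by apply/funext => y; rewrite laplacian_potential !sE.
have mf : measurable_fun (@torus_cell R) f.
  apply/measurable_EFinP; apply: measurable_funM => //; apply: measurable_funTS.
  apply: measurableT_comp => //; apply: measurable_funM.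
  - by apply: (measurableT_comp (f := sgn : mR -> R));
    [exact: measurable_sgn|exact: measurable_fst].
  - by apply: (measurableT_comp (f := sgn : mR -> R));
    [exact: measurable_sgn|exact: measurable_snd].
(* The zeros of sin(2 pi t) in the cell, where every square wave is 0 and differs from [sgn]; the
   lines over them form the null set [N]. *)
pose F : set mR := [set 0] `|` [set 2^-1] `|` [set - 2^-1].
have mF : measurable F.
  by apply: measurableU; [apply: measurableU|]; exact: measurable_set1.
have F0 : leb F = 0%E.
  apply: countable_lebesgue_measure0; apply: finite_set_countable.
  by rewrite /F !finite_setU; split; [split|]; exact: finite_set1.
pose N : set (mR * mR) := (F `*` setT) `|` (setT `*` F).
have mN : measurable N by apply: measurableU; apply: measurableX => //; exact: measurableT.
have N0 : area N = 0%E.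
  apply: null_set_setU.
  - by apply: measurableX => //; exact: measurableT.
  - by apply: measurableX => //; exact: measurableT.
  - apply: (etrans (product_measure1E _ _ mF measurableT)).
    by apply/eqP; rewrite mule_eq0; apply/orP; left; apply/eqP.
  - apply: (etrans (product_measure1E _ _ measurableT mF)).
    by apply/eqP; rewrite mule_eq0; apply/orP; right; apply/eqP.
have ff : {ae area, forall y, torus_cell y -> f_ n y @[n --> \oo] --> f y}.
  exists N; split => // -[y1 y2] /= /not_implyP[[/=]]; rewrite !in_itv/= => c1 c2 nc.
  apply: contrapT => /not_orP[n1 n2]; apply: nc.
  have itvF t : - 2^-1 <= t <= 2^-1 -> ~ F t -> square_wave n t @[n --> \oo] --> sgn t.
    move=> /andP[t1 t2] nF; apply: square_wave_cvg.
      rewrite !lt_neqAle t1 t2 !andbT; apply/andP; split; apply/eqP => tE; apply: nF.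
        by right; rewrite /= -tE.
      by left; right.
    by apply/eqP => tE; apply: nF; left; left.
  have nF1 : ~ F y1 by move=> Fy; apply: n1.
  have nF2 : ~ F y2 by move=> Fy; apply: n2.
  apply: cvg_EFin; first exact: nearW.
  apply: cvgM; first exact: cvg_cst.
  by apply: cvgN; apply: cvgM; exact: itvF.
have bnd : {ae area, forall y n, torus_cell y -> (`|f_ n y| <= `|(EFin \o Kx) y|)%E}.
  apply: aeW => y n _; rewrite /f_/= lee_fin normrM normrN ler_piMr// normrM.
  by rewrite -[leRHS]mulr1 ler_pM// iter_sharpen_le1// ler_norml sin_geN1 sin_le1.
have [fi _ fcvg] := dominated_convergence mcell mf_ mf ff (integrable_abse iK) bnd.
by apply: fine_cvg; rewrite fineK //; exact: integrable_fin_num fi.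
Qed.

Lemma bahouri_chemin_gt0 K x : is_torus_green K -> Tpp x -> 0 < bahouri_chemin K x.
Proof.
move=> hK Tx.
have [s sE] := choice (@odd_trig_square_wave R).
pose s0 : seq (R * int) := [:: (1, 1%:Z)].
have osc0 t : osc s0 t = sin (2 * pi * t).
  by rewrite /osc big_cons big_nil /freq addr0 mul1r mulr1.
have p0 : 0 < potential s0 x.
  rewrite potentialE !big_cons !big_nil !addr0 /freq /= !mulr1.
  have [x1 x2] := Tx; have S1 := sin2pi_gt0 x1; have S2 := sin2pi_gt0 x2.
  have pp : 0 < (2 * pi : R) ^+ 2 by rewrite exprn_gt0// mulr_gt0// pi_gt0.
  by rewrite !mulr_gt0// invr_gt0 addr_gt0.
(* A bound uniform in [n] keeps the limit positive. Sharpening only increases the source on [Tpp],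
   and the factor 1/2 makes the comparison strict. *)
have low n : 2^-1 * potential s0 x <= potential (s n) x.
  rewrite -subr_le0.
  have cv : continuous (fun y => 2^-1 * potential s0 y - potential (s n) y).
    move=> y; apply: (@cvgB _ _ _ (nbhs y)); last exact: trig_continuous.
    by apply: (@cvgM _ _ (nbhs y)); [exact: cvg_cst|exact: trig_continuous].
  pose v y := 2^-1 * potential s0 y - potential (s n) y.
  apply: (@square_comparison _ v v) Tx => //.
  - move=> y sy nT; have Z k : potential k y = 0.
      apply: (@odd_periodic_boundary _ (potential k)) => //.
      + exact: potential_biperiodic.
      + by move=> a b; exact: potential_odd2.
      + by move=> a b; exact: potential_odd1.
    by rewrite /v !Z mulr0 subr0.
  - by move=> y _; exact: cv.
  - move=> y [y1 y2] _; eexists; last first.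
      apply: laplacian_atB; first apply: laplacian_atZ.
        by apply: (C2_on_laplacian_at (@openT _)) => //; exact: C2_on_trig.
      by apply: (C2_on_laplacian_at (@openT _)) => //; exact: C2_on_trig.
    rewrite !laplacian_potential !osc0 -!sE.
    have S1 := sin2pi_gt0 y1; have S2 := sin2pi_gt0 y2.
    have /(iter_sharpen_itv n)/andP[h1 _] : 0 <= sin (2 * pi * y.1) <= 1.
      by rewrite (ltW S1) sin_le1.
    have /(iter_sharpen_itv n)/andP[h2 _] : 0 <= sin (2 * pi * y.2) <= 1.
      by rewrite (ltW S2) sin_le1.
    have : sin (2 * pi * y.1) * sin (2 * pi * y.2) <= square_wave n y.1 * square_wave n y.2.
      by apply: ler_pM => //; exact: ltW.
    have : 0 < sin (2 * pi * y.1) * sin (2 * pi * y.2) by rewrite mulr_gt0.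
    lra.
apply: (@lt_le_trans _ _ (2^-1 * potential s0 x)); first by rewrite mulr_gt0.
apply: (cvgr_to_ge (torus_conv_square_wave hK Tx)); apply: nearW => n.
rewrite (_ : (fun _ => _) = fun y => - (osc (s n) y.1 * osc (s n) y.2)); last first.
  by apply/funext => y; rewrite !sE.
by rewrite torus_conv_potential.
Qed.

End BahouriChemin.

(** * The theorem *)

Section Bounds.
Context {R : realType}.
Implicit Types (x : R * R) (s eps sigma : R) (K phi Psi : R * R -> R).

Lemma solution_gt0 K s eps phi x : is_torus_green K -> is_solution K s eps phi ->
  Tpp x -> 0 < phi x.
Proof.
move=> hK [[_ _ _ _ ge] _ _ _] Tx.
exact: lt_le_trans (bahouri_chemin_gt0 hK Tx) (ge _ Tx).
Qed.

(** On the arc of radius [rho], with [L = - ln eps], the barrier is at most [C L^(2 - al) x1 x2] and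
    the solution at least [(L / 16) x1 x2]; it remains to take [L] large. *)
Lemma lower_bound K s : is_torus_green K -> 0 < s < 1 ->
  exists2 eps0, 0 < eps0 <= 1 & forall eps, 0 < eps < eps0 -> forall phi Psi,
    is_solution K s eps phi -> is_barrier s eps Psi ->
    forall x, Rpp x -> nsq x <= (Num.sqrt eps / - ln eps) ^+ 2 -> Psi x <= phi x.
Proof.
move=> hK s01; have [C C0 HC] := barrier_le s01; have /andP[s0 s1] := s01.
set al := 2 / (1 + s) in HC.
have s10 : 1 + s != 0 by rewrite gt_eqF// addr_gt0.
have al1 : 1 < al by rewrite ltr_pdivlMr; lra.
have al2 : al < 2 by rewrite ltr_pdivrMr; lra.
(* The power yields [16 * C <= L ^ (al - 1)]; the 8 yields [rho < 1/2] and [8 <= L ^+ 2]. *)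
pose L0 := 8 + (16 * C) `^ (al - 1)^-1.
have L08 : 8 <= L0 by rewrite lerDl powR_ge0.
exists (expR (- L0)); first by rewrite expR_gt0/= -expR0 ler_expR; lra.
move=> eps /andP[e0 eL] phi Psi hphi hP.
pose L := - ln eps.
have LL0 : L0 < L.
  by rewrite /L ltrNr -(expRK (- L0)) ltr_ln ?posrE ?expR_gt0.
have L8 : 8 < L by lra.
have Lp : 0 < L by lra.
have CL : 16 * C <= L `^ (al - 1).
  have h : (16 * C) `^ (al - 1)^-1 <= L by move: LL0; rewrite /L0; lra.
  have -> : 16 * C = ((16 * C) `^ (al - 1)^-1) `^ (al - 1).
    by rewrite -powRrM mulVf ?powRr1 ?mulr_ge0 ?ltW// gt_eqF//; lra.
  by apply: ge0_ler_powR; rewrite ?nnegrE ?powR_ge0//; lra.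
set rho := Num.sqrt eps / L.
have rhoE : rho ^+ 2 = eps / L ^+ 2 by rewrite expr_div_n sqr_sqrtr// ltW.
have e1 : eps < 1.
  by apply: lt_le_trans eL _; rewrite -expR0 ler_expR; lra.
have L2 : 64 <= L ^+ 2 by nra.
have r0 : 0 < rho by rewrite divr_gt0// sqrtr_gt0.
have r20 : 0 < rho ^+ 2 by rewrite exprn_gt0.
have r2 : rho ^+ 2 < 64^-1.
  rewrite rhoE ltr_pdivrMr ?exprn_gt0//; apply: lt_le_trans e1 _; lra.
have rhalf : rho < 2^-1 by nra.
apply: (barrier_le_solution s0 e0 _ hphi _ hP).
- by rewrite r0.
- by move=> y; exact: solution_gt0 hK hphi.
move=> y yp yr.
have Ty : Tpp y.
  by have [y1 y2] := yp; split; apply/andP; split => //; move: yr r2; rewrite /nsq; nra.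
apply: le_trans (HC _ _ _ e0 hP yp) _.
apply: le_trans (solution_ge s0 e0 r20 hphi (fun y => solution_gt0 hK hphi) Ty).
have y12 : 0 < y.1 * y.2 by have [y1 y2] := yp; rewrite mulr_gt0.
rewrite mono1// yr.
(* The powers of [eps] cancel because [s / (1 + s) + al / 2 = 1]. *)
have E : eps `^ (s / (1 + s)) * (rho ^+ 2) `^ (al / 2 - 1) = L `^ (2 - al).
  rewrite rhoE powRM ?invr_ge0 ?sqr_ge0 ?(ltW e0)// mulrA -powRD; last first.
    by rewrite (gt_eqF e0) implybT.
  rewrite (_ : s / (1 + s) + (al / 2 - 1) = 0); last by rewrite /al; field.
  rewrite powRr0 mul1r -powR_inv1 ?sqr_ge0// -powRrM -powR_mulrn ?(ltW Lp)// -powRrM.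
  by congr powR; field.
rewrite (_ : _ * _ * (_ * _) =
  C * (eps `^ (s / (1 + s)) * (rho ^+ 2) `^ (al / 2 - 1)) * (y.1 * y.2)); last by ring.
rewrite E [leRHS](_ : _ = (- (16^-1 * (ln (rho ^+ 2 + rho ^+ 2) + ln 4))) * (y.1 * y.2));
  last by ring.
rewrite ler_pM2r// -lnM ?posrE ?addr_gt0//.
(* The logarithm becomes [ln (8 / L ^+ 2) - L], whose first term is at most 0. *)
have -> : (rho ^+ 2 + rho ^+ 2) * 4 = (8 / L ^+ 2) * eps by rewrite rhoE; ring.
have L20 : 0 < L ^+ 2 by rewrite exprn_gt0.
rewrite lnM ?posrE ?divr_gt0// -[ln eps]opprK -/L.
have : ln (8 / L ^+ 2) <= 0 by apply: ln_le0; rewrite ler_pdivrMr//; lra.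
have : 16 * C * L `^ (2 - al) <= L.
  apply: (@le_trans _ _ (L `^ (al - 1) * L `^ (2 - al))).
    by rewrite ler_wpM2r ?powR_ge0.
  rewrite -powRD; last by rewrite (gt_eqF Lp) implybT.
  by rewrite (_ : al - 1 + (2 - al) = 1) ?powRr1 ?(ltW Lp)//; ring.
lra.
Qed.

(** With [b = 2 - sigma / 2] in [solution_le] and [barrier_ge] for [Psi], the claim reduces to
    comparing powers of [nsq x <= eps], with [eps^(- sigma / 4)] to spare for the constants. *)
Lemma upper_bound K s sigma : is_torus_green K -> 0 < s < 1 -> 0 < sigma < s / 2 ->
  exists2 eps0, 0 < eps0 & forall eps, 0 < eps < eps0 -> forall phi Psi,
    is_solution K s eps phi -> is_barrier s eps Psi ->
    forall x, Tpp x -> nsq x <= eps ->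
      phi x <= Psi x * (1 + eps `^ (- sigma) * enorm x `^ sigma).
Proof.
move=> hK s01 /andP[sig0 sigs]; have /andP[s0 s1] := s01.
pose al := 2 / (1 + s).
have s10 : 0 < 1 + s by rewrite addr_gt0.
have sne : 1 + s != 0 by rewrite gt_eqF.
pose b := 2 - sigma / 2.
have b02 : 0 < b < 2 by apply/andP; split; rewrite /b; lra.
have b4 : 0 < 4 - b ^+ 2 by case/andP: b02 => ? ?; nra.
pose B := 16 / (4 - b ^+ 2).
have B0 : 0 < B by rewrite divr_gt0.
have B40 : 0 < 4 * B by exact: mulr_gt0.
(* Solves [eps0 ^ (- (sigma / 4)) = 4 * B]. *)
pose eps0 := (4 * B) `^ (- (4 / sigma)).
exists eps0; first by rewrite powR_gt0// mulr_gt0.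
move=> eps /andP[e0 eE] phi Psi hphi hP x Tx xe.
have xp := Tpp_Rpp Tx; have N0 := nsq_gt0 xp.
have x12 : 0 < x.1 * x.2 by have [x1 x2] := xp; rewrite mulr_gt0.
apply: le_trans (solution_le s0 e0 b02 hphi hP Tx) _.
rewrite -/B mulrDr mulr1 lerD2l.
have -> : enorm x `^ sigma = nsq x `^ (sigma / 2).
  by rewrite /enorm -[_ + _]/(nsq x) -powR12_sqrt ?(ltW N0)// -powRrM mulrC.
apply: (@le_trans _ _ (4^-1 * eps `^ (s / (1 + s)) * mono 1 al x *
    (eps `^ (- sigma) * nsq x `^ (sigma / 2)))); last first.
  rewrite ler_wpM2r ?mulr_ge0 ?powR_ge0//; exact: barrier_ge s01 e0 hP xp.
rewrite !mono1//.
(* The exponent left when [sigma / 2] and [al / 2 - 1] are taken out of [b / 2 - 1]; it is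
   nonnegative because [sigma < s / 2]. *)
pose e := s / (1 + s) - 3 / 4 * sigma.
have e_ge0 : 0 <= e.
  have : s / 2 <= s / (1 + s) by rewrite ler_pM2l// lef_pV2 ?posrE//; lra.
  rewrite /e; lra.
have bE : nsq x `^ (b / 2 - 1) = nsq x `^ e * nsq x `^ (sigma / 2) * nsq x `^ (al / 2 - 1).
  rewrite -!powRD ?(gt_eqF N0) ?implybT//; congr powR.
  by rewrite /b /e /al; field.
rewrite bE.
have H : B * nsq x `^ e <= 4^-1 * (eps `^ (s / (1 + s)) * eps `^ (- sigma)).
  apply: (@le_trans _ _ (B * eps `^ e)).
    by rewrite ler_pM2l//; apply: ge0_ler_powR; rewrite ?nnegrE// ltW.
  rewrite -powRD ?(gt_eqF e0) ?implybT//.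
  rewrite (_ : s / (1 + s) - sigma = e + - (sigma / 4)); last by rewrite /e; field.
  rewrite (@powRD _ eps e) ?(gt_eqF e0) ?implybT// (mulrCA 4^-1) (mulrC B) ler_pM2l
    ?powR_gt0//.
  suff : 4 * B <= eps `^ (- (sigma / 4)) by lra.
  have -> : 4 * B = eps0 `^ (- (sigma / 4)).
    rewrite -powRrM (_ : - (4 / sigma) * - (sigma / 4) = 1) ?powRr1//; last first.
      by field; rewrite gt_eqF.
    exact: ltW.
  have E0 : 0 < eps0 by rewrite powR_gt0// mulr_gt0.
  rewrite !powRN lef_pV2 ?posrE ?powR_gt0//.
  by apply: ge0_ler_powR; rewrite ?nnegrE; lra.
have Q : 0 <= nsq x `^ (sigma / 2) * nsq x `^ (al / 2 - 1) * (x.1 * x.2).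
  by apply: mulr_ge0; [apply: mulr_ge0; exact: powR_ge0|exact: ltW].
rewrite [leLHS](_ : _ = B * nsq x `^ e * (nsq x `^ (sigma / 2) * nsq x `^ (al / 2 - 1) *
  (x.1 * x.2))); last by ring.
apply: le_trans (ler_wpM2r Q H) _.
by rewrite le_eqVlt; apply/orP; left; apply/eqP; ring.
Qed.

End Bounds.

Theorem theorem1p2 (R : realType) (K : R * R -> R) (hK : is_torus_green K)
    (s : R) (hs : 0 < s < 1) :
  exists sigma : R, 0 < sigma < s / 100 /\
  exists eps0 : R, 0 < eps0 /\
  forall eps : R, 0 < eps < eps0 ->
  forall phi Psi : R * R -> R,
    is_solution K s eps phi -> is_barrier s eps Psi ->
  forall x : R * R, Tpp x -> enorm x <= Num.sqrt eps / - ln eps ->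
    Psi x <= phi x <= Psi x * (1 + eps `^ (- sigma) * enorm x `^ sigma).
Proof.
have /andP[s0 s1] := hs; exists (s / 200); split; first by apply/andP; split; lra.
have [E1 /andP[E10 E11] low] := lower_bound hK hs.
have [E2 E20 up] : exists2 eps0, 0 < eps0 & forall eps, 0 < eps < eps0 -> forall phi Psi,
    is_solution K s eps phi -> is_barrier s eps Psi ->
    forall x, Tpp x -> nsq x <= eps ->
      phi x <= Psi x * (1 + eps `^ (- (s / 200)) * enorm x `^ (s / 200)).
  by apply: (upper_bound hK hs); apply/andP; split; lra.
(* The bound [expR (- 1)] gives [- ln eps > 1], so the points considered satisfy [nsq x <= eps], as
   the upper bound requires. *)
exists (Num.min (Num.min E1 E2) (expR (- 1))); split;
  first by rewrite !lt_min E10 E20 expR_gt0.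
move=> eps; rewrite !lt_min => /and3P[e0 /andP[eE1 eE2] ee] phi Psi hphi hP x Tx xr.
have L1 : 1 < - ln eps by rewrite ltrNr -(expRK (- 1)) ltr_ln ?posrE ?expR_gt0.
have xN : nsq x <= (Num.sqrt eps / - ln eps) ^+ 2.
  rewrite -(sqr_sqrtr (nsq_ge0 x)) ler_pXn2r ?nnegrE ?sqrtr_ge0//.
  by apply: divr_ge0; [exact: sqrtr_ge0|lra].
apply/andP; split; first by apply: low hphi hP _ (Tpp_Rpp Tx) xN; rewrite e0.
apply: up hphi hP _ Tx _; first by rewrite e0.
apply: le_trans xN _; rewrite expr_div_n sqr_sqrtr ?(ltW e0)//.
have L2 : 1 <= (- ln eps) ^+ 2 by rewrite exprn_ege1// ltW.
by rewrite ler_pdivrMr ?(lt_le_trans ltr01 L2)// ler_peMr// ltW.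
Qed.
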